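(* Let $\Gamma$ be a finite simplicial graph which is connected, triangle-free and has at least two edges. The kernel $K_0$ of the homomorphism $$R_0=\prod_{v\in V_0}R_{J_v}: Out^0(A_\Gamma)\to\prod_{v\in V_0}Out(A_{J_v})$$ is a finitely generated free abelian group, generated by (the classes of) conjugations by separating vertices $v$ on non-leaf components of $\Gamma-\{v\}$. If $\Gamma$ is a star, the kernel is trivial; otherwise it has rank $\sum_{v\in V_0}(\delta_C(v)-\ell(v)-1)$.
   Context: $V$ is the vertex set of $\Gamma$ and $A_\Gamma=\langle V \mid vw=wv \text{ if } v,w \text{ are joined by an edge}\rangle$. For a full subgraph $\Theta$, $A_\Theta$ is the subgroup generated by the vertices of $\Theta$. $lk(v)$ is the set of neighbours of $v$, $st(v)=lk(v)\cup\{v\}$. $\Gamma$ is a star if $\Gamma=st(v)$ (the full subgraph spanned) for some vertex $v$. A leaf is a vertex of valence one in $\Gamma$; other vertices are interior. $Out^0(A_\Gamma)$ is the image in $Out(A_\Gamma)$ of the group $Aut^0(A_\Gamma)$ generated by inner automorphisms, inversions ($v\mapsto v^{-1}$, other generators fixed), partial conjugations (conjugate by $v$ all generators in one connected component of $\Gamma-st(v)$) and transvections ($w\mapsto wv$, other generators fixed, for $v\ne w$ with $lk(w)\subseteq st(v)$). For an interior vertex $v$: $L_v=lk(v)$, $L_v^\perp=\bigcap_{u\in L_v}st(u)$, and $J_v=L_v*L_v^\perp$, which is a maximal join (complete bipartite subgraph not properly contained in another one). For every maximal join $J$, each element of $Out^0(A_\Gamma)$ has a representative in $Aut^0(A_\Gamma)$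 mapping $A_J$ to itself; its restriction to $A_J$ gives a well-defined element of $Out(A_J)$, and this defines the restriction homomorphism $R_J:Out^0(A_\Gamma)\to Out(A_J)$. The set $V_0$: call vertices $v,w$ equivalent if $L_v=L_w$, and partially order equivalence classes by $[v]\le[w]$ if $L_v\subseteq L_w$. $V_0$ consists of one chosen vertex from each maximal equivalence class, except that if $\Gamma$ is a star $\{v\}*W$ one sets $V_0=\{v\}$. A vertex $v$ is separating if $\Gamma-\{v\}$ is disconnected. For a component $C$ of $\Gamma-\{v\}$, the conjugation by $v$ on $C$ is the automorphism conjugating all generators in $C$ by $v$ and fixing all other generators. A component of $\Gamma-\{v\}$ is a leaf component if it consists of a single vertex (then a leaf attached to $v$), and a non-leaf component otherwise. $\delta_C(v)$ is the number of connected components of $\Gamma-\{v\}$, and $\ell(v)$ is the number of leaves adjacent to $v$. *)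

(* Defs.v *)
From HB Require Import structures.
From mathcomp Require Import all_boot all_order all_algebra.
From mathcomp Require Import boolp classical_sets.

Set Implicit Arguments.
Unset Strict Implicit.
Unset Printing Implicit Defensive.

Import GRing.Theory.

Local Open Scope quotient_scope.

Record sgraph := SGraph {
  vertex :> finType;
  adj : rel vertex;
  adj_sym : symmetric adj;
  adj_irr : irreflexive adj }.

Section Graphs.
Variable G : sgraph.
Implicit Types (v w u : G) (S C : {set G}).

Definition edges : {set {set G}} := [set [set p.1; p.2] | p : G * G & adj p.1 p.2].

Definition graph_connected := forall v w, connect (@adj G) v w.

Definition triangle_free := forall v w u, ~~ [&& adj v w, adj w u & adj u v].

Definition lk v : {set G} := [set w | adj v w].
Definition st v : {set G} := v |: lk v.

Definition leaf v := #|lk v| == 1.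
Definition interior v := ~~ leaf v.

(* The vertex sets of the connected components of the full subgraph on S. *)
Definition components S : {set {set G}} :=
  equivalence_partition
    (connect [rel v w | [&& v \in S, w \in S & adj v w]]) S.

Definition separating v := 1 < #|components (~: [set v])|.

Definition deltaC v : nat := #|components (~: [set v])|.
Definition num_leaves v : nat := #|[set w in lk v | leaf w]|.

Definition is_star := [exists v, st v == [set: G]].

Definition lk_perp v : {set G} := \bigcap_(u in lk v) st u.

(* The vertex set of the join lk v * lk_perp v. *)
Definition join_of v : {set G} := lk v :|: lk_perp v.

(* The classes of interior vertices under lk v = lk w, ordered by inclusion
   of links. *)
Definition maximal_class v :=
  interior v /\ forall w, interior w -> lk v \subset lk w -> lk w = lk v.

Definition is_V0 (V0 : {set G}) : Prop :=
  if is_star then exists v, st v = [set: G] /\ V0 = [set v]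
  else (forall v, v \in V0 -> maximal_class v) /\
       (forall u, maximal_class u -> #|[set v in V0 | lk v == lk u]| = 1).

End Graphs.

Section GroupGeneralities.
Local Open Scope group_scope.
Local Open Scope classical_set_scope.
Variable A : groupType.

Definition gen_subgroup (X : set A) : set A :=
  smallest (fun H : set A => group_closed [in H]) X.

Lemma gen_subgroup_closed (X : set A) : group_closed [in gen_subgroup X].
Proof.
have memP (H : set A) x : reflect (H x) (x \in [in H]).
  by rewrite unfold_in; apply: (iffP idP) => [/set_mem|/mem_set].
split=> [|x y /memP xX /memP yX]; apply/memP => H [/[dup] Hc [H1 HF] HX].
  exact/memP.
by apply/memP/HF; apply/memP; [apply: xX|apply: yX].
Qed.

Definition free_abelian_of_rank (K : set A) (r : nat) : Prop :=
  exists f : 'rV[int]_r -> A,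
    [/\ injective f, {morph f : x y / (x + y)%R >-> x * y} & range f = K].

Definition is_aut (f : A -> A) : bool :=
  `[< bijective f /\ {morph f : x y / x * y} >].

Record aut := Aut { aut_fun :> A -> A; _ : is_aut aut_fun }.

HB.instance Definition _ := [isSub for aut_fun].
HB.instance Definition _ := [Choice of aut by <:].

Lemma autP (f : aut) : bijective f /\ {morph f : x y / x * y}.
Proof. exact/asboolP/(valP f). Qed.

Lemma aut_eqP (f g : aut) : (forall x, f x = g x) -> f = g.
Proof. by move=> fg; apply/val_inj/funext. Qed.

Definition aut_inv_fun (f : aut) (y : A) : A :=
  xget 1 [set x | f x = y].

Lemma aut_invK (f : aut) : cancel (aut_inv_fun f) f.
Proof.
move=> y; have [[g _ gK] _] := autP f.
by rewrite /aut_inv_fun; case: xgetP => // /(_ (g y)) /=; rewrite gK.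
Qed.

Lemma autK (f : aut) : cancel f (aut_inv_fun f).
Proof. by move=> x; apply: (bij_inj (autP f).1); rewrite aut_invK. Qed.

Lemma aut_inv_subproof (f : aut) : is_aut (aut_inv_fun f).
Proof.
apply/asboolP; split; first exact: Bijective (aut_invK f) (autK f).
move=> x y; apply: (bij_inj (autP f).1).
by rewrite (autP f).2 !aut_invK.
Qed.

Lemma aut_mul_subproof (f g : aut) : is_aut (f \o g).
Proof.
apply/asboolP; split; first exact: bij_comp (autP f).1 (autP g).1.
by move=> x y; rewrite /= (autP g).2 (autP f).2.
Qed.

Lemma aut_one_subproof : is_aut id.
Proof. by apply/asboolP; split=> //; exists id. Qed.

Definition aut_mul (f g : aut) : aut := Aut (aut_mul_subproof f g).
Definition aut_one : aut := Aut aut_one_subproof.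
Definition aut_inv (f : aut) : aut := Aut (aut_inv_subproof f).

Lemma aut_mulA : associative aut_mul.
Proof. by move=> f g h; apply: aut_eqP. Qed.
Lemma aut_mul1 : left_id aut_one aut_mul.
Proof. by move=> f; apply: aut_eqP. Qed.
Lemma aut_mulr1 : right_id aut_one aut_mul.
Proof. by move=> f; apply: aut_eqP. Qed.
Lemma aut_mulV : left_inverse aut_one aut_inv aut_mul.
Proof. by move=> f; apply: aut_eqP => x; apply: autK. Qed.
Lemma aut_mulrV : right_inverse aut_one aut_inv aut_mul.
Proof. by move=> f; apply: aut_eqP => x; apply: aut_invK. Qed.

HB.instance Definition _ :=
  isGroup.Build aut aut_mulA aut_mul1 aut_mulr1 aut_mulV aut_mulrV.

Definition inner (f : aut) : Prop := exists g, forall x, f x = x ^ g.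

(* f and g have the same class modulo inner automorphisms. *)
Definition outer_eq (f g : aut) : bool := `[< inner (f * g^-1) >].

Lemma outer_eqP (f g : aut) :
  reflect (exists a, forall x, f x = g x ^ a) (outer_eq f g).
Proof.
apply: (iffP (asboolP _)) => -[a fg]; exists a => x.
  by rewrite -fg /= autK.
by rewrite /= fg aut_invK.
Qed.

Lemma outer_eq_refl : reflexive outer_eq.
Proof. by move=> f; apply/outer_eqP; exists 1 => x; rewrite conjg1. Qed.

Lemma outer_eq_sym : symmetric outer_eq.
Proof.
by move=> f g; apply/outer_eqP/outer_eqP => -[a fg]; exists a^-1 => x;
  rewrite fg conjgK.
Qed.

Lemma outer_eq_trans : transitive outer_eq.
Proof.
move=> g f h /outer_eqP[a fg] /outer_eqP[b gh]; apply/outer_eqP.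
by exists (b * a) => x; rewrite fg gh conjgM.
Qed.

Canonical outer_equiv :=
  EquivRel outer_eq outer_eq_refl outer_eq_sym outer_eq_trans.

Definition out := {eq_quot outer_equiv}.
HB.instance Definition _ := Choice.on out.
HB.instance Definition _ := EqQuotient.on out.

Definition out_class (f : aut) : out := \pi_out f.

Lemma out_classP (f g : aut) :
  out_class f = out_class g <-> exists a, forall x, f x = g x ^ a.
Proof.
by split=> [/eqmodP/outer_eqP //|fg]; apply/eqmodP/outer_eqP.
Qed.

Definition out_mul (o p : out) : out := out_class (repr o * repr p).
Definition out_one : out := out_class 1.
Definition out_inv (o : out) : out := out_class (repr o)^-1.

Lemma aut_conj (f : aut) x y : f (x ^ y) = f x ^ f y.
Proof.
apply: (mulgI (f y)); rewrite -(autP f).2 /conjg mulgA mulgV mul1g (autP f).2.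
by rewrite mulgA mulgV mul1g.
Qed.

Lemma out_reprK (o : out) : out_class (repr o) = o.
Proof. exact: reprK. Qed.

Lemma out_mulE f g : out_mul (out_class f) (out_class g) = out_class (f * g).
Proof.
have /out_classP[a fa] := out_reprK (out_class f).
have /out_classP[b gb] := out_reprK (out_class g).
apply/out_classP; exists (f b * a) => x /=.
by rewrite fa gb aut_conj conjgM.
Qed.

Lemma out_invE f : out_inv (out_class f) = out_class f^-1.
Proof.
have /out_classP[a fa] := out_reprK (out_class f).
apply/out_classP; exists (f^-1 a^-1) => x.
apply: (bij_inj (autP (repr (out_class f))).1).
by rewrite [LHS]aut_invK fa aut_conj ![f _]aut_invK conjgKV.
Qed.

Lemma out_mulA : associative out_mul.
Proof.
move=> o p q; rewrite -[o]out_reprK -[p]out_reprK -[q]out_reprK.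
by rewrite !out_mulE mulgA.
Qed.
Lemma out_mul1 : left_id out_one out_mul.
Proof. by move=> o; rewrite -[o]out_reprK out_mulE mul1g. Qed.
Lemma out_mulr1 : right_id out_one out_mul.
Proof. by move=> o; rewrite -[o]out_reprK out_mulE mulg1. Qed.
Lemma out_mulV : left_inverse out_one out_inv out_mul.
Proof. by move=> o; rewrite -[o]out_reprK out_invE out_mulE mulVg. Qed.
Lemma out_mulrV : right_inverse out_one out_inv out_mul.
Proof. by move=> o; rewrite -[o]out_reprK out_invE out_mulE mulgV. Qed.

HB.instance Definition _ :=
  isGroup.Build out out_mulA out_mul1 out_mulr1 out_mulV out_mulrV.

End GroupGeneralities.

Section RAAG.
Variable G : sgraph.

(* (v, true) stands for the letter v, (v, false) for the letter v^-1. *)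
Definition word := seq (G * bool).

Inductive word_eq : word -> word -> Prop :=
| word_refl s : word_eq s s
| word_sym s t : word_eq s t -> word_eq t s
| word_trans s t u : word_eq s t -> word_eq t u -> word_eq s u
| word_cancel s t v b : word_eq (s ++ [:: (v, b); (v, ~~ b)] ++ t) (s ++ t)
| word_comm s t v w : adj v w ->
    word_eq (s ++ [:: (v, true); (w, true)] ++ t)
            (s ++ [:: (w, true); (v, true)] ++ t).

Definition word_eqb (s t : word) : bool := `[< word_eq s t >].

Lemma word_eqb_refl : reflexive word_eqb.
Proof. by move=> s; apply/asboolP/word_refl. Qed.
Lemma word_eqb_sym : symmetric word_eqb.
Proof. by move=> s t; apply/asboolP/asboolP => /word_sym. Qed.
Lemma word_eqb_trans : transitive word_eqb.
Proof.
by move=> t s u /asboolP st /asboolP tu; apply/asboolP/(word_trans st tu).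
Qed.

Canonical word_equiv :=
  EquivRel word_eqb word_eqb_refl word_eqb_sym word_eqb_trans.

Definition raag := {eq_quot word_equiv}.
HB.instance Definition _ := Choice.on raag.
HB.instance Definition _ := EqQuotient.on raag.

Definition word_class (s : word) : raag := \pi_raag s.

Lemma word_classP s t : word_class s = word_class t <-> word_eq s t.
Proof. by split=> [/eqmodP/asboolP //|st]; apply/eqmodP/asboolP. Qed.

Lemma raag_reprK (x : raag) : word_class (repr x) = x.
Proof. exact: reprK. Qed.

Lemma word_eq_cat s s' t t' :
  word_eq s s' -> word_eq t t' -> word_eq (s ++ t) (s' ++ t').
Proof.
move=> ss' tt'; apply: (@word_trans _ (s' ++ t)).
  elim: ss' => {s s'} [s|s s' _ ih|s s' s'' _ ih1 _ ih2|s s' v b|s s' v w vw].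
  - exact: word_refl.
  - exact: word_sym.
  - exact: word_trans ih1 ih2.
  - by rewrite -!catA; apply: word_cancel.
  - by rewrite -!catA; apply: word_comm.
elim: tt' => {t t'} [t|t t' _ ih|t t' t'' _ ih1 _ ih2|t t' v b|t t' v w vw].
- exact: word_refl.
- exact: word_sym.
- exact: word_trans ih1 ih2.
- by rewrite !(catA s' t); apply: word_cancel.
- by rewrite !(catA s' t); apply: word_comm.
Qed.

Definition inv_letter (l : G * bool) := (l.1, ~~ l.2).
Definition word_inv (s : word) : word := rev (map inv_letter s).

Lemma word_invK : involutive word_inv.
Proof.
move=> s; rewrite /word_inv map_rev revK -map_comp map_id_in // => -[v b] _.
by rewrite /inv_letter /= negbK.
Qed.

Lemma word_mulV s : word_eq (word_inv s ++ s) [::].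
Proof.
elim: s => [|[v b] s ih]; first exact: word_refl.
apply: word_trans ih; rewrite /word_inv /= rev_cons -cats1 -catA /=.
by have := word_cancel (word_inv s) s v (~~ b); rewrite negbK.
Qed.

Lemma word_mulrV s : word_eq (s ++ word_inv s) [::].
Proof. by rewrite -{1}[s]word_invK; apply: word_mulV. Qed.

Definition raag_mul (x y : raag) : raag := word_class (repr x ++ repr y).
Definition raag_one : raag := word_class [::].
Definition raag_inv (x : raag) : raag := word_class (word_inv (repr x)).

Lemma raag_mulE s t : raag_mul (word_class s) (word_class t) = word_class (s ++ t).
Proof.
apply/word_classP/word_eq_cat.
  exact/word_classP/raag_reprK.
exact/word_classP/raag_reprK.
Qed.

Lemma raag_mulA : associative raag_mul.
Proof.
move=> x y z; rewrite -[x]raag_reprK -[y]raag_reprK -[z]raag_reprK.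
by rewrite !raag_mulE catA.
Qed.
Lemma raag_mul1 : left_id raag_one raag_mul.
Proof. by move=> x; rewrite -[x]raag_reprK raag_mulE. Qed.
Lemma raag_mulr1 : right_id raag_one raag_mul.
Proof. by move=> x; rewrite -[x]raag_reprK raag_mulE cats0. Qed.
Lemma raag_mulV : left_inverse raag_one raag_inv raag_mul.
Proof.
move=> x; rewrite -{2}[x]raag_reprK raag_mulE.
exact/word_classP/word_mulV.
Qed.
Lemma raag_mulrV : right_inverse raag_one raag_inv raag_mul.
Proof.
move=> x; rewrite -{1}[x]raag_reprK raag_mulE.
exact/word_classP/word_mulrV.
Qed.

HB.instance Definition _ :=
  isGroup.Build raag raag_mulA raag_mul1 raag_mulr1 raag_mulV raag_mulrV.

Definition gen (v : G) : raag := word_class [:: (v, true)].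

End RAAG.

Section Outer.
Local Open Scope group_scope.
Local Open Scope classical_set_scope.
Variable G : sgraph.
Implicit Types (v w u : G) (S C : {set G}) (f : aut (raag G)).

(* Automorphisms of A_G are specified by their values on the generators, which
   determine them. *)
Definition conj_on v C f : Prop :=
  forall u, f (gen u) = if u \in C then gen u ^ gen v else gen u.

Inductive aut0_generator f : Prop :=
| aut0_inner : inner f -> aut0_generator f
| aut0_inversion v :
    (forall u, f (gen u) = if u == v then (gen v)^-1 else gen u) ->
    aut0_generator f
| aut0_partial_conj v C :
    C \in components (~: st v)%SET -> conj_on v C f -> aut0_generator f
| aut0_transvection v w :
    v != w -> lk w \subset st v ->
    (forall u, f (gen u) = if u == w then gen w * gen v else gen u) ->
    aut0_generator f.

Definition Aut0 : set (aut (raag G)) := gen_subgroup aut0_generator.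

Definition Out0 : set (out (raag G)) := @out_class (raag G) @` Aut0.

Definition special_subgroup S : set (raag G) :=
  gen_subgroup (@gen G @` [set` S]).

Record special S := Special {
  special_val : raag G;
  _ : special_val \in special_subgroup S }.

HB.instance Definition _ S := [isSub for @special_val S].
HB.instance Definition _ S := [Choice of special S by <:].
HB.instance Definition _ S :=
  SubChoice_isSubGroup.Build (raag G) [in special_subgroup S] (special S)
    (@gen_subgroup_closed _ _).

(* p is the class of the restriction to A_S of a representative of o in Aut^0
   mapping A_S to itself. *)
Definition restricts_to S (o : out (raag G)) (p : out (special S)) : Prop :=
  exists (f : aut (raag G)) (g : aut (special S)),
    [/\ Aut0 f, out_class f = o, forall x, val (g x) = f (val x)
      & out_class g = p].

(* If S spans a maximal join, every o in Out0 restricts to exactly one class,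
   and the default value 1 is reached only outside Out0. *)
Definition restriction S (o : out (raag G)) : out (special S) :=
  xget 1 [set p | restricts_to o p].

Definition R0 (V0 : {set G}) (o : out (raag G)) :
    forall i : {v | v \in V0}, out (special (join_of (val i))) :=
  fun i => restriction (join_of (val i)) o.

Definition K0 (V0 : {set G}) : set (out (raag G)) :=
  [set o | Out0 o /\ @R0 V0 o = fun=> 1].

Definition nonleaf_conjugations : set (out (raag G)) :=
  [set o | exists v C f,
    [/\ separating v, C \in components (~: [set v])%SET, #|C| != 1%N,
        conj_on v C f & out_class f = o]].

End Outer.

Arguments Out0 : clear implicits.
Arguments nonleaf_conjugations : clear implicits.

(* Main.v *)
Require Import Defs.
From HB Require Import structures.
From mathcomp Require Import all_boot all_order all_algebra.
From mathcomp Require Import boolp classical_sets.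
From mathcomp Require Import zify ring.

(* Every class in K0 is represented by an automorphism acting on each special
   subgroup A_J, J = J_v with v in V0, as a conjugation; conversely, the
   retraction of A_Gamma onto A_J shows that an automorphism acting on A_J as a
   conjugation restricts to the trivial class.

   Let f be such an automorphism, normalized to be the identity on one J_v.  If
   w in V0 is adjacent to v, then f is on J_w the conjugation by an element
   commuting with v and w, that is by v^m w^n, and it maps x to x^(v^m) for x
   in the link of w.  For a vertex x outside the star of v, the exponent of v in
   an element conjugating x to f(x) is determined by f (look at the affine group
   with v acting as t -> 2t and x as t -> t + 1), and it is constant on each
   component of Gamma - v.  So f can be composed with a power of the conjugation
   by v on the component of w to become the identity on J_w, without losing the
   joins on which it already was the identity.  As V0 spans a connected graph,
   this ends with the identity.

   The conjugations commute modulo inner automorphisms, because a component can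
   be traded for its complement.  For each v in V0, the conjugations by v on all
   the non-leaf components have an inner product; leaving one of them out, the
   differences of the exponents of v show that there is no other relation. *)

Set Implicit Arguments.
Unset Strict Implicit.
Unset Printing Implicit Defensive.

Import Order.TTheory GRing.Theory Num.Theory.
Local Open Scope group_scope.

(** * Integer powers, generated subgroups and automorphisms as morphisms *)

Section IntegerPowers.
Variable A : groupType.
Implicit Types (x y : A) (m n : int).

Definition zpow x n : A :=
  match n with Posz k => x ^+ k | Negz k => x ^- k.+1 end.

Lemma zpow1 x : zpow x 1 = x. Proof. exact: expg1. Qed.

Lemma zpowS x n : zpow x (n + 1)%R = x * zpow x n.
Proof.
case: n => [k|[|k]]; first by rewrite -PoszD addn1 /= expgS.
  by rewrite /= expg1 mulgV.
rewrite NegzE (_ : (- (k.+2)%:Z + 1)%R = Negz k); last by rewrite NegzE; lia.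
by rewrite /= (expgSr x k.+1) invgM mulgA mulgV mul1g.
Qed.

Lemma zpowD x m n : zpow x (m + n)%R = zpow x m * zpow x n.
Proof.
elim: m => [|k ih|k ih]; first by rewrite add0r mul1g.
  by rewrite -addn1 PoszD -!addrA [(1 + n)%R]addrC addrA !zpowS ih mulgA.
apply: (mulgI x); rewrite mulgA -!zpowS.
rewrite (_ : - k.+1%:Z + n + 1 = - k%:Z + n)%R; last by lia.
by rewrite (_ : - k.+1%:Z + 1 = - k%:Z)%R; last by lia.
Qed.

Lemma zpowN x n : zpow x (- n)%R = (zpow x n)^-1.
Proof. by apply: (mulgI (zpow x n)); rewrite -zpowD subrr mulgV. Qed.

Lemma commute_zpow x y n : commute x y -> commute x (zpow y n).
Proof.
by move=> xy; case: n => k; [apply: commuteX|apply/commuteV/commuteX].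
Qed.

Lemma commute_zpow2 x y m n : commute x y -> commute (zpow x m) (zpow y n).
Proof.
by move=> xy; apply/commute_zpow/commute_sym/commute_zpow/commute_sym.
Qed.

Lemma commute_conjg x y : commute x y -> x ^ y = x.
Proof. by move=> xy; rewrite conjgE xy mulKg. Qed.

Lemma conjg_commute x y : x ^ y = x -> commute x y.
Proof. by move=> xy; rewrite /commute conjgC xy. Qed.

End IntegerPowers.

Section GeneratedSubgroups.
Variable A : groupType.
Local Open Scope classical_set_scope.
Implicit Types (X : set A).

Lemma gen_subgroup_sub X : X `<=` gen_subgroup X.
Proof. by move=> x Xx H [_ XH]; apply: XH. Qed.

Lemma gen_subgroup_ind X (P : A -> Prop) :
  P 1 -> (forall x y, P x -> P y -> P (x * y)) ->
  (forall x, P x -> P x^-1) -> (forall x, X x -> P x) ->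
  forall x, gen_subgroup X x -> P x.
Proof.
move=> P1 PM PV XP x; apply; split=> //; split; first exact/mem_set.
by move=> u v /set_mem Pu /set_mem Pv; apply/mem_set/PM => //; apply: PV.
Qed.

Lemma gen_subgroup1 X : gen_subgroup X 1.
Proof. by have [/set_mem] := gen_subgroup_closed X. Qed.

Lemma gen_subgroupM X x y :
  gen_subgroup X x -> gen_subgroup X y -> gen_subgroup X (x * y).
Proof.
move=> /mem_set Xx /mem_set Xy; apply/set_mem.
exact: (group_closedM (gen_subgroup_closed X)).
Qed.

Lemma gen_subgroupV X x : gen_subgroup X x -> gen_subgroup X x^-1.
Proof.
move=> /mem_set Xx; apply/set_mem.
exact: (group_closedV (gen_subgroup_closed X)).
Qed.

Lemma gen_subgroupJ X x y :
  gen_subgroup X x -> gen_subgroup X y -> gen_subgroup X (x ^ y).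
Proof.
by move=> Xx Xy; apply: gen_subgroupM;
  [apply: gen_subgroupV|apply: gen_subgroupM].
Qed.

Lemma gen_subgroup_zpow X x n : gen_subgroup X x -> gen_subgroup X (zpow x n).
Proof.
move=> Xx; have XX k : gen_subgroup X (x ^+ k).
  elim: k => [|k ih]; first exact: gen_subgroup1.
  by rewrite expgS; apply: gen_subgroupM.
by case: n => k; [exact: XX|apply: gen_subgroupV (XX k.+1)].
Qed.

End GeneratedSubgroups.

Section Morphisms.
Variables A B : groupType.

Lemma gmulf_zpow (f : UMagmaMorphism.type A B) x n :
  f (zpow x n) = zpow (f x) n.
Proof. by case: n => k; [exact: gmulfXn|exact: gmulfXVn]. Qed.

End Morphisms.

Section AutMorphism.
Variable A : groupType.

Lemma aut_div (f : aut A) : {morph f : x y / x / y}.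
Proof.
move=> x y; have fM := (autP f).2; apply: (mulIg (f y)).
by rewrite -fM !mulgVK.
Qed.

HB.instance Definition _ (f : aut A) :=
  isGroupMorphism.Build A A f (@aut_div f).

Lemma autM (f : aut A) : {morph f : x y / x * y}. Proof. exact: gmulfM. Qed.

Lemma autV (f : aut A) : {morph f : x / x^-1}. Proof. exact: gmulfV. Qed.

Lemma aut1 (f : aut A) : f 1 = 1. Proof. exact: gmulf1. Qed.

Lemma aut_zpow (f : aut A) x n : f (zpow x n) = zpow (f x) n.
Proof. exact: gmulf_zpow. Qed.

Lemma aut_mulgE (f g : aut A) x : (f * g) x = f (g x). Proof. by []. Qed.

Lemma aut_invgK (f : aut A) : cancel f^-1 f. Proof. exact: aut_invK. Qed.

Lemma aut_invgKV (f : aut A) : cancel f f^-1. Proof. exact: autK. Qed.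

Lemma conj_aut_subproof (a : A) : is_aut (conjg^~ a).
Proof.
apply/asboolP; split=> [|x y]; last exact: conjMg.
exists (conjg^~ a^-1); [exact: conjgK|exact: conjgKV].
Qed.

Definition conj_aut a : aut A := Aut (conj_aut_subproof a).

Lemma out_class1P (f : aut A) :
  out_class f = 1 <-> exists a, forall x, f x = x ^ a.
Proof. exact: (out_classP f 1). Qed.

Lemma out_class_conj a : out_class (conj_aut a) = 1.
Proof. by apply/out_class1P; exists a. Qed.

Lemma out_class_div (f g : aut A) :
  out_class (f / g) = out_class f / out_class g.
Proof. by rewrite -out_mulE -out_invE. Qed.

HB.instance Definition _ :=
  isGroupMorphism.Build (aut A) (out A) (@out_class A) out_class_div.

End AutMorphism.

(** * The universal property of A_Gamma *)

Section RaagMorphisms.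
Variable G : sgraph.
Implicit Types (v w u : G).

Lemma word_class_cat (s t : word G) :
  word_class (s ++ t) = word_class s * word_class t.
Proof. exact/esym/raag_mulE. Qed.

Lemma word_class_letter v b :
  word_class [:: (v, b)] = if b then gen v else (gen v)^-1.
Proof.
case: b => //; apply: (mulgI (gen v)); rewrite mulgV -word_class_cat.
exact/word_classP/(word_cancel [::] [::]).
Qed.

Lemma raag_ind (P : raag G -> Prop) :
  P 1 -> (forall v x, P x -> P (gen v * x)) ->
  (forall v x, P x -> P ((gen v)^-1 * x)) -> forall x, P x.
Proof.
move=> P1 PM PV x; rewrite -[x]raag_reprK.
elim: (repr x) => [//|[v b] s ih].
rewrite -cat1s word_class_cat word_class_letter.
by case: b; [apply: PM|apply: PV].
Qed.

Lemma gen_commute v w : adj v w -> commute (gen v) (gen w).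
Proof.
move=> vw; rewrite /commute -!word_class_cat.
exact/word_classP/(word_comm [::] [::]).
Qed.

Section Lift.
Variables (H : groupType) (h : G -> H).

Definition word_eval (s : word G) : H :=
  foldr (fun l x => (if l.2 then h l.1 else (h l.1)^-1) * x) 1 s.

Lemma word_eval_cat s t : word_eval (s ++ t) = word_eval s * word_eval t.
Proof. by elim: s => [|l s ih] /=; rewrite ?mul1g // ih mulgA. Qed.

Definition raag_lift (x : raag G) : H := word_eval (repr x).

Hypothesis h_comm : forall v w, adj v w -> commute (h v) (h w).

Lemma word_eval_eq s t : word_eq s t -> word_eval s = word_eval t.
Proof.
elim=> {s t} [//|s t _ ->|s t u _ -> _ ->|s t v b|s t v w vw] //.
  rewrite !word_eval_cat /=; congr (_ * _).
  by case: b; rewrite /= mulg1 ?mulgV ?mulVg mul1g.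
by rewrite !word_eval_cat /= !mulg1 h_comm.
Qed.

Lemma raag_lift_word s : raag_lift (word_class s) = word_eval s.
Proof. exact/word_eval_eq/word_classP/raag_reprK. Qed.

Lemma raag_liftM : {morph raag_lift : x y / x * y}.
Proof.
move=> x y; rewrite -[x]raag_reprK -[y]raag_reprK -word_class_cat.
by rewrite !raag_lift_word word_eval_cat.
Qed.

Lemma raag_lift_gen v : raag_lift (gen v) = h v.
Proof. by rewrite raag_lift_word /= mulg1. Qed.

Lemma raag_lift_div : {morph raag_lift : x y / x / y}.
Proof.
by move=> x y; apply: (mulIg (raag_lift y)); rewrite -raag_liftM !mulgVK.
Qed.

Fact raag_hom_subproof :
  {f : UMagmaMorphism.type (raag G) H | forall v, f (gen v) = h v}.
Proof.
pose f : UMagmaMorphism.type (raag G) H :=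
  HB.pack raag_lift (isGroupMorphism.Build _ _ raag_lift raag_lift_div).
by exists f => v; apply: raag_lift_gen.
Qed.

(* Opaque, so that simplification does not unfold it to a fold over words. *)
Definition raag_hom := sval raag_hom_subproof.

Lemma raag_hom_gen v : raag_hom (gen v) = h v.
Proof. exact: (svalP raag_hom_subproof). Qed.

End Lift.

Lemma raag_hom_eq (H : groupType) (f g : UMagmaMorphism.type (raag G) H) :
  (forall v, f (gen v) = g (gen v)) -> forall x, f x = g x.
Proof.
move=> fg; elim/raag_ind => [|v x ih|v x ih]; first by rewrite !gmulf1.
  by rewrite !gmulfM fg ih.
by rewrite !gmulfM !gmulfV fg ih.
Qed.

Lemma aut_raag_eq (f g : aut (raag G)) :
  (forall v, f (gen v) = g (gen v)) -> f = g.
Proof. by move=> fg; apply/aut_eqP/raag_hom_eq. Qed.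

End RaagMorphisms.

(** * Affine representations and exponents of vertices *)

Section AffineGroup.
Local Open Scope ring_scope.

(* The pair (m, a) is the affine map t |-> 2 ^ m * t + a. *)
Definition affine := (int * rat)%type.
HB.instance Definition _ := Choice.on affine.

Definition affine_mul (p q : affine) : affine :=
  (p.1 + q.1, p.2 + 2%:Q ^ p.1 * q.2).
Definition affine_one : affine := (0, 0).
Definition affine_inv (p : affine) : affine := (- p.1, - (2%:Q ^ (- p.1) * p.2)).

Lemma affine_mulA : associative affine_mul.
Proof.
move=> [m a] [n b] [k c]; rewrite /affine_mul /= addrA exprzDr //.
by congr pair; ring.
Qed.

Lemma affine_mul1 : left_id affine_one affine_mul.
Proof. by move=> [m a]; rewrite /affine_mul /= expr0z mul1r !add0r. Qed.

Lemma affine_mulr1 : right_id affine_one affine_mul.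
Proof. by move=> [m a]; rewrite /affine_mul /= mulr0 !addr0. Qed.

Lemma affine_mulV : left_inverse affine_one affine_inv affine_mul.
Proof. by move=> [m a]; rewrite /affine_mul /= !addNr. Qed.

Lemma affine_mulrV : right_inverse affine_one affine_inv affine_mul.
Proof.
move=> [m a]; rewrite /affine_mul /= mulrN mulrA -exprzDr // !subrr expr0z.
by rewrite mul1r subrr.
Qed.

HB.instance Definition _ := isGroup.Build affine
  affine_mulA affine_mul1 affine_mulr1 affine_mulV affine_mulrV.

Lemma affine_mulE (p q : affine) :
  (p * q)%g = (p.1 + q.1, p.2 + 2%:Q ^ p.1 * q.2).
Proof. by []. Qed.

Lemma affine_invE (p : affine) :
  (p^-1)%g = (- p.1, - (2%:Q ^ (- p.1) * p.2)).
Proof. by []. Qed.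

Lemma affine_conjg (p : affine) :
  (((0%R, 1%R) : affine) ^ p)%g = (0, 2%:Q ^ (- p.1)).
Proof.
case: p => m a; rewrite conjgE !affine_mulE affine_invE /=.
rewrite expr0z mul1r mulrDr mulr1 add0r addNr.
by congr pair; ring.
Qed.

Lemma exprz2_inj : injective (fun m : int => 2%:Q ^ m).
Proof. by move=> m n /= /ieexprIz; apply. Qed.

End AffineGroup.

Section Exponents.
Variable G : sgraph.
Implicit Types (v w u x : G) (a b c : raag G).

Definition affine_gen v x u : affine :=
  ((u == v)%:Z, ((u == x) && (x \notin st v))%:R)%R.

(** The images of [v] and [x] can fail to commute only if [x] lies outside the star of [v], and then
    the two vertices are not adjacent. *)
Lemma affine_gen_comm v x u w :
  adj u w -> commute (affine_gen v x u) (affine_gen v x w).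
Proof.
move=> uw; have wu : adj w u by rewrite adj_sym.
have nuw : u != w by apply: contraTneq uw => ->; rewrite adj_irr.
rewrite /commute !affine_mulE /affine_gen /= !inE negb_or.
case: (eqVneq u v) => uv; case: (eqVneq w v) => wv;
  case: (eqVneq u x) => ux; case: (eqVneq w x) => wx; subst;
  rewrite ?eqxx ?uw ?wu ?andbF //= ?mulr0 ?addr0 ?add0r ?expr0z ?mul1r //;
  by rewrite 1?addrC // eqxx in nuw.
Qed.

(* The affine representation of [A_G] in which [v] acts as the homothety of
   ratio 2 and, if [x] is not in the star of [v], [x] as the unit
   translation. *)
Definition affine_rep v x := raag_hom (@affine_gen_comm v x).

Lemma affine_rep_gen v x u : affine_rep v x (gen u) = affine_gen v x u.
Proof. exact: raag_hom_gen. Qed.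

(** With [x = v] the translation parts of the generators vanish, and the exponent sum of [v]
    remains. *)
Definition expo v a : int := (affine_rep v v a).1.

Lemma expoM v a b : expo v (a * b) = (expo v a + expo v b)%R.
Proof. by rewrite /expo gmulfM. Qed.

Lemma expo1 v : expo v 1 = 0%R.
Proof. by rewrite /expo gmulf1. Qed.

Lemma expoV v a : expo v a^-1 = (- expo v a)%R.
Proof. by apply: (addrI (expo v a)); rewrite -expoM mulgV expo1 subrr. Qed.

Lemma expoJ v a b : expo v (a ^ b) = expo v a.
Proof. by rewrite !expoM expoV addrCA addNr addr0. Qed.

Lemma expo_gen v u : expo v (gen u) = (u == v)%:Z%R.
Proof. by rewrite /expo affine_rep_gen. Qed.

Lemma expo_zpow v a n : expo v (zpow a n) = (n * expo v a)%R.
Proof.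
elim: n => [|k ih|k ih]; first by rewrite expo1 mul0r.
  by rewrite -addn1 PoszD zpowD zpow1 expoM ih mulrDl mul1r.
rewrite -addn1 PoszD opprD zpowD expoM ih zpowN zpow1 expoV.
by rewrite mulrDl mulN1r.
Qed.

Lemma affine_rep1 v x a : (affine_rep v x a).1 = expo v a.
Proof.
elim/raag_ind: a => [|u a ih|u a ih]; first by rewrite expo1 gmulf1.
  by rewrite gmulfM affine_mulE affine_rep_gen ih expoM expo_gen.
by rewrite gmulfM gmulfV affine_mulE affine_rep_gen ih expoM expoV expo_gen.
Qed.

(** Conjugating the unit translation by an affine map divides it by the ratio of the map, so the
    result reveals the exponent of [v] in the conjugator. *)
Lemma expo_conj_eq v x a b :
  v \notin st x -> gen x ^ a = gen x ^ b -> expo v a = expo v b.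
Proof.
rewrite !inE negb_or adj_sym => /andP[vx nvx].
have xv : x \notin st v by rewrite !inE negb_or eq_sym vx.
move=> /(congr1 (affine_rep v x)); rewrite !gmulfJ affine_rep_gen /affine_gen.
rewrite eq_sym (negPf vx) eqxx xv /= !affine_conjg !affine_rep1 => -[].
by move/exprz2_inj/oppr_inj.
Qed.

Lemma expo_morph v (f : UMagmaMorphism.type (raag G) (raag G)) a :
  (forall u, expo v (f (gen u)) = expo v (gen u)) -> expo v (f a) = expo v a.
Proof.
move=> fE; elim/raag_ind: a => [|u a ih|u a ih]; first by rewrite gmulf1.
  by rewrite gmulfM !expoM fE ih.
by rewrite gmulfM gmulfV !expoM !expoV fE ih.
Qed.

End Exponents.

(** * Special subgroups and retractions *)

Section SpecialSubgroups.
Variable G : sgraph.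
Implicit Types (v w u : G) (S T : {set G}).
Local Open Scope classical_set_scope.

Lemma special_gen S v : v \in S -> special_subgroup S (gen v).
Proof. by move=> vS; apply: gen_subgroup_sub; exists v. Qed.

Lemma special1 S : special_subgroup S 1.
Proof. exact: gen_subgroup1. Qed.

Lemma specialM S x y :
  special_subgroup S x -> special_subgroup S y -> special_subgroup S (x * y).
Proof. exact: gen_subgroupM. Qed.

Lemma specialV S x : special_subgroup S x -> special_subgroup S x^-1.
Proof. exact: gen_subgroupV. Qed.

Lemma special_ind S (P : raag G -> Prop) :
  P 1 -> (forall x y, P x -> P y -> P (x * y)) ->
  (forall x, P x -> P x^-1) -> (forall v, v \in S -> P (gen v)) ->
  forall x, special_subgroup S x -> P x.
Proof.
by move=> P1 PM PV PX; apply: gen_subgroup_ind => // _ [v vS <-]; apply: PX.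
Qed.

Lemma special_morph_eq S (H : groupType)
    (f g : UMagmaMorphism.type (raag G) H) :
  (forall v, v \in S -> f (gen v) = g (gen v)) ->
  forall x, special_subgroup S x -> f x = g x.
Proof.
move=> fg; apply: special_ind => //; first by rewrite !gmulf1.
- by move=> x y; rewrite !gmulfM => -> ->.
- by move=> x; rewrite !gmulfV => ->.
Qed.

Lemma special_full x : special_subgroup [set: G] x.
Proof.
elim/raag_ind: x => [|v x ih|v x ih]; first exact: special1.
  by apply: specialM => //; apply: special_gen; rewrite inE.
apply: specialM => //; apply: specialV.
by apply: special_gen; rewrite inE.
Qed.

Section Retraction.
Variable S : {set G}.

Definition retract_gen v : raag G := if v \in S then gen v else 1.

Lemma retract_gen_comm v w :
  adj v w -> commute (retract_gen v) (retract_gen w).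
Proof.
rewrite /retract_gen => vw.
case: ifP => _; last exact/commute_sym/commute1.
by case: ifP => _; [exact: gen_commute|exact: commute1].
Qed.

Definition retract := raag_hom retract_gen_comm.

Lemma retract_genE v : retract (gen v) = if v \in S then gen v else 1.
Proof. exact: raag_hom_gen. Qed.

Lemma retract_in x : special_subgroup S (retract x).
Proof.
have rg v : special_subgroup S (retract (gen v)).
  by rewrite retract_genE; case: ifP => vS;
    [apply: special_gen|apply: special1].
elim/raag_ind: x => [|v x ih|v x ih]; first by rewrite gmulf1; apply: special1.
  by rewrite gmulfM; apply: specialM (rg v) ih.
by rewrite gmulfM gmulfV; apply: specialM (specialV (rg v)) ih.
Qed.

Lemma retract_id x : special_subgroup S x -> retract x = x.
Proof.
apply: (special_morph_eq (f := retract) (g := idfun)) => v vS.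
by rewrite retract_genE vS.
Qed.

End Retraction.

(** The retraction onto A_T fixes [x] and kills the generators of A_S lying outside [T]. *)
Lemma special_setI S T x :
  special_subgroup S x -> special_subgroup T x -> special_subgroup (S :&: T)%SET x.
Proof.
move=> Sx Tx; rewrite -(retract_id Tx); move: x Sx {Tx}; apply: special_ind.
- by rewrite gmulf1; apply: special1.
- by move=> x y; rewrite gmulfM; apply: specialM.
- by move=> x; rewrite gmulfV; apply: specialV.
- move=> v vS; rewrite retract_genE; case: ifP => vT; last exact: special1.
  by apply: special_gen; rewrite inE vS.
Qed.

Lemma special_edge v w x : adj v w -> special_subgroup [set v; w]%SET x ->
  exists m n, x = zpow (gen w) n * zpow (gen v) m.
Proof.
move=> vw; move: x; apply: special_ind.
- by exists 0%R, 0%R; rewrite /= mulg1.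
- move=> _ _ [m [n ->]] [m' [n' ->]]; exists (m + m')%R, (n + n')%R.
  rewrite !zpowD -!mulgA; congr (_ * _); rewrite !mulgA; congr (_ * _).
  exact/commute_zpow2/gen_commute.
- move=> _ [m [n ->]]; exists (- m)%R, (- n)%R; rewrite invgM !zpowN -!zpowN.
  exact/commute_zpow2/gen_commute.
- move=> u; rewrite !inE => /orP[/eqP->|/eqP->].
    by exists 1%R, 0%R; rewrite zpow1 mul1g.
  by exists 0%R, 1%R; rewrite zpow1 mulg1.
Qed.

End SpecialSubgroups.

(** * Centralizers in A_G *)

Section Pilings.
Variable G : sgraph.
Implicit Types (v w u : G) (l m : G * bool) (s t : word G).

(* One stack per vertex: the letter [v] or [v^-1] puts its sign on the stack of
   [v] and a blank [None] on the stacks of the vertices not commuting with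
   [v].  Two reduced words are equal in [A_G] iff they have the same piling. *)
Definition piling := {ffun G -> seq (option bool)}.
Implicit Types (p q : piling).

Definition push l p : piling :=
  [ffun u => if u == l.1 then Some l.2 :: p u
             else if adj u l.1 then p u else None :: p u].
Definition pop v p : piling := [ffun u => if adj u v then p u else behead (p u)].
Definition top p v : option (option bool) := ohead (p v).
Definition cancels l p := top p l.1 == Some (Some (~~ l.2)).
(** Left multiplication by a letter. Since [pop] discards heads without inspecting them, the group
    relations are checked on pilings of reduced words. *)
Definition act l p := if cancels l p then pop l.1 p else push l p.

Definition piling0 : piling := [ffun=> [::]].
Definition pile s := foldr push piling0 s.
Definition normal s := foldr act piling0 s.
Fixpoint reduced s :=
  if s is l :: t then reduced t && ~~ cancels l (pile t) else true.

Lemma pushK l : cancel (push l) (pop l.1).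
Proof.
move=> p; apply/ffunP => u; rewrite !ffunE.
by case: (eqVneq u l.1) => [->|_]; [rewrite adj_irr|case: (adj u l.1)].
Qed.

Lemma pushC l m p : adj l.1 m.1 -> push l (push m p) = push m (push l p).
Proof.
move=> lm; have ml : adj m.1 l.1 by rewrite adj_sym.
apply/ffunP => u; rewrite !ffunE.
case: (eqVneq u l.1) => [->|_].
  rewrite lm; case: eqP => // lm'; by rewrite lm' adj_irr in lm.
case: (eqVneq u m.1) => [->|_]; first by rewrite ml.
by case: (adj u l.1); case: (adj u m.1).
Qed.

Lemma top_push l p : top (push l p) l.1 = Some (Some l.2).
Proof. by rewrite /top ffunE eqxx. Qed.

Lemma push_adj l p u : adj u l.1 -> push l p u = p u.
Proof.
move=> ul; rewrite ffunE ul; case: eqP => // ul'.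
by rewrite ul' adj_irr in ul.
Qed.

Lemma act_adj l p u : adj u l.1 -> act l p u = p u.
Proof.
by move=> ul; rewrite /act; case: ifP => _; rewrite ?push_adj // ffunE ul.
Qed.

Lemma word_class_cons l s :
  word_class (l :: s) = word_class [:: l] * word_class s.
Proof. by rewrite -word_class_cat. Qed.

Lemma word_class_comm l m s : adj l.1 m.1 ->
  word_class (l :: m :: s) = word_class (m :: l :: s).
Proof.
move=> lm; rewrite -![_ :: _ :: s]/([:: _; _] ++ s) !word_class_cat.
congr (_ * _); rewrite [LHS]word_class_cons [RHS]word_class_cons.
case: l m lm => [v a] [w b] /= /gen_commute vw; rewrite !word_class_letter.
by case: a; case: b => //; apply/commute_sym;
  do ?[apply: commuteV]; apply/commute_sym => //; apply: commuteV.
Qed.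

(** A preceding letter not commuting with this one would have left a blank above it on the stack of
    [v]. So it commutes with all letters before it and can be brought to the front. *)
Lemma reduced_top s v b : reduced s -> top (pile s) v = Some (Some b) ->
  exists t, [/\ reduced ((v, b) :: t), word_class s = word_class ((v, b) :: t),
                pile s = pile ((v, b) :: t) & size s = (size t).+1].
Proof.
elim: s => [|l s ih]; first by rewrite /top ffunE.
rewrite /= {1}/top ffunE => /andP[rs lcs].
case: (eqVneq v l.1) => [vl [<-]|vl].
  by exists s; rewrite vl -surjective_pairing rs.
case: ifP => // vl_adj /(ih rs)[t [/= /andP[rt vct] ws ps ss]].
have lv : adj l.1 v by rewrite adj_sym.
exists (l :: t); split=> /=; last by rewrite ss.
- rewrite rt /=; apply/andP; split.
    by move: lcs; rewrite ps /cancels /top push_adj.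
  by rewrite /cancels /top push_adj.
- rewrite -(word_class_comm (l := l) (m := (v, b))) //.
  by rewrite word_class_cons ws -word_class_cons.
- by rewrite ps pushC.
Qed.

Lemma cancel_act s v b : reduced s -> act (v, b) (act (v, ~~ b) (pile s)) = pile s.
Proof.
move=> rs; rewrite {2}/act; case: ifP => [|_].
  rewrite /cancels negbK /= => /eqP/(reduced_top rs)[t [/= /andP[_ vct] _ -> _]].
  by rewrite (pushK (v, b)) /act (negPf vct).
by rewrite /act /cancels top_push eqxx (pushK (v, ~~ b)).
Qed.

Lemma cancel_actC s l m : reduced s -> adj l.1 m.1 -> cancels l (pile s) ->
  act l (act m (pile s)) = act m (act l (pile s)).
Proof.
case: l m => [v a] [w b] /= rs vw /[dup] cl.
have wv : adj w v by rewrite adj_sym.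
have cl' : cancels (v, a) (act (w, b) (pile s)).
  by rewrite /cancels /top act_adj.
rewrite {1}/act cl' [act (v, a) _]/act cl.
move: cl cl'; rewrite {1}/cancels /= => /eqP.
move=> /(reduced_top rs)[t [/= /andP[rt _] _ -> _]] _ _.
have cm : cancels (w, b) (push (v, ~~ a) (pile t)) = cancels (w, b) (pile t).
  by rewrite /cancels /top push_adj.
rewrite (pushK (v, ~~ a)) {1}/act cm /act; case: ifP => [|_]; last first.
  by rewrite pushC // (pushK (v, ~~ a)).
move=> /eqP/(reduced_top rt)[t' [/= _ _ -> _]].
by rewrite pushC // !(pushK (w, ~~ b)) (pushK (v, ~~ a)).
Qed.

Lemma actC s l m : reduced s -> adj l.1 m.1 ->
  act l (act m (pile s)) = act m (act l (pile s)).
Proof.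
move=> rs lm; have ml : adj m.1 l.1 by rewrite adj_sym.
case cl : (cancels l (pile s)); first exact: cancel_actC.
case cm : (cancels m (pile s)); first by rewrite -cancel_actC.
rewrite [in RHS]/act cl [X in act l X]/act cm /act /cancels /top !push_adj //.
by move: cl cm; rewrite /cancels /top => -> ->; rewrite pushC.
Qed.

Lemma normal_reduced s : reduced s -> normal s = pile s.
Proof. by elim: s => //= l s ih /andP[/ih-> lcs]; rewrite /act (negPf lcs). Qed.

(** The final alternative, that the word is kept or gets strictly shorter, lets [reduce] recognize
    reduced words by their length. *)
Lemma reduce_cons l s : reduced s ->
  exists t, [/\ reduced t, word_class t = word_class (l :: s),
                pile t = act l (pile s) & t = l :: s \/ (size t < size s)%N].
Proof.
move=> rs; case cl : (cancels l (pile s)); last first.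
  by exists (l :: s); rewrite /= rs cl /act cl; split=> //; left.
have /eqP/(reduced_top rs)[t [/= /andP[rt _] ws ps ss]] := cl.
exists t; split=> //; last by right; rewrite ss.
  rewrite word_class_cons ws -word_class_cons; apply/esym/word_classP.
  by case: (l) => v b; apply: (word_cancel [::]).
by rewrite /act cl ps (pushK (l.1, ~~ l.2)).
Qed.

Lemma normal_pile s : exists2 t, reduced t & normal s = pile t.
Proof.
elim: s => [|l s [t rt st]] /=; first by exists [::].
by rewrite st; have [t' [rt' _ <- _]] := reduce_cons l rt; exists t'.
Qed.

(** Every suffix has the piling of a reduced word, and there [act] respects the defining
    relations. *)
Lemma normal_word_eq s t : word_eq s t -> normal s = normal t.
Proof.
rewrite /normal; elim=> {s t} [//|s t _ ->|s t u _ -> _ ->|s t v b|s t v w vw] //.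
  rewrite !foldr_cat /= -/(normal t).
  by have [t' rt' ->] := normal_pile t; rewrite cancel_act.
rewrite !foldr_cat /= -/(normal t).
by have [t' rt' ->] := normal_pile t; rewrite actC.
Qed.

Lemma reduced_pile_eq s t : reduced s -> reduced t ->
  word_class s = word_class t -> pile s = pile t.
Proof.
by move=> rs rt /word_classP/normal_word_eq; rewrite !normal_reduced.
Qed.

(** Every letter contributes exactly one sign, so a piling determines the length of its word. *)
Lemma size_pile s : (\sum_u count isSome (pile s u) = size s)%N.
Proof.
elim: s => [|l s ih] /=; first by apply: big1 => u _; rewrite ffunE.
rewrite -ih (bigD1 l.1) //= ffunE eqxx /=.
rewrite (bigD1 l.1 (F := fun u => count _ (pile s u))) //=.
rewrite add1n addSn; congr (_ + _).+1; apply: eq_bigr => u ul.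
by rewrite ffunE (negPf ul); case: ifP.
Qed.

Lemma reduced_size_eq s t : reduced s -> reduced t ->
  word_class s = word_class t -> size s = size t.
Proof. by move=> rs rt st; rewrite -!size_pile (reduced_pile_eq rs rt st). Qed.

Lemma reduce s : exists t, [/\ reduced t, word_class t = word_class s,
  (size t <= size s)%N & size t = size s -> reduced s].
Proof.
elim: s => [|l s [t [rt st lets rs]]]; first by exists [::].
have [t' [rt' t's _ t't]] := reduce_cons l rt.
have ws : word_class (l :: t) = word_class (l :: s).
  by rewrite word_class_cons st -word_class_cons.
exists t'; rewrite t's; case: t't => [t'E|/= lt_t't]; split=> //=; last 2 first.
- lia.
- lia.
- by rewrite t'E.
rewrite t'E => -[/rs rs']; rewrite rs' /=; move: rt'; rewrite t'E /=.
by case/andP=> _; rewrite (reduced_pile_eq rt rs' st).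
Qed.

Lemma pile_cat s t v : pile (s ++ t) v = pile s v ++ pile t v.
Proof.
elim: s => [|l s ih] /=; first by rewrite ffunE.
by rewrite !ffunE ih; case: ifP => // _; case: ifP.
Qed.

Lemma rcons_cons_constant (T : eqType) (a : T) (r : seq T) :
  a :: r = r ++ [:: a] -> all (pred1 a) r.
Proof.
by elim: r => [|b r ih] //= [<-] /ih ->; rewrite eqxx.
Qed.

(** A letter outside the star of [v] would put a blank on the stack of [v]. *)
Lemma pile_signs_special s v :
  None \notin pile s v -> special_subgroup (st v) (word_class s).
Proof.
elim: s => [|l s ih] /=; first by move=> _; apply: special1.
rewrite ffunE word_class_cons => lsv.
have lv : l.1 \in st v.
  rewrite !inE [adj v _]adj_sym; move: lsv; rewrite eq_sym.
  case: (l.1 == v) => //=; rewrite [adj v _]adj_sym.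
  by case: (adj l.1 v).
apply: specialM; last first.
  by apply: ih; move: lsv; do 2!case: ifP => // _; rewrite inE.
case: l lv {lsv} => u b /= uv; rewrite word_class_letter.
by case: b; [|apply: specialV]; apply: special_gen.
Qed.

(** Induction on the length of a reduced word [s] for [c]. A letter [v] or its inverse that can be
    brought to the front is stripped. Otherwise [v s] and [s v] are both reduced, and comparing
    their pilings at [v] shows that no blank occurs there. *)
Lemma centralizer_gen v c : commute c (gen v) -> special_subgroup (st v) c.
Proof.
rewrite -[c]raag_reprK; have [s [rs <- _ _]] := reduce (repr c).
have [n] := ubnP (size s); elim: n s rs => // n ih s rs lt_s cv.
have [[b /(reduced_top rs)[t [/= /andP[rt _] ws _ ss]]]|ntv] :=
    pselect (exists b, top (pile s) v = Some (Some b)).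
  have vv : commute (gen v) (word_class [:: (v, b)]).
    by rewrite word_class_letter; case: b {ws}; [|apply: commuteV].
  rewrite ws word_class_cons; apply: specialM.
    rewrite word_class_letter; case: b {ws vv}; [|apply: specialV];
      by apply: special_gen; rewrite !inE eqxx.
  apply: ih => //; first by rewrite -ltnS -ss.
  rewrite -[word_class t](mulKg (word_class [:: (v, b)])) -word_class_cons -ws.
  apply: commute_sym; apply: commuteM; last exact: commute_sym.
  exact: commuteV.
have rvs : reduced ((v, true) :: s).
  by rewrite /= rs; apply: contra_notN ntv => /eqP; exists false.
have vsE : word_class ((v, true) :: s) = word_class (s ++ [:: (v, true)]).
  by rewrite word_class_cons word_class_cat cv.
(* The word [s v] is reduced because it has the length of [v s], a reduced word for the same
   element. *)
have [t [rt tsv _ rsv]] := reduce (s ++ [:: (v, true)]).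
have rsv' : reduced (s ++ [:: (v, true)]).
  apply: rsv; rewrite (reduced_size_eq rt rvs) ?vsE ?tsv //.
  by rewrite size_cat addn1.
have /ffunP/(_ v) := reduced_pile_eq rvs rsv' vsE.
(* Adding the sign of [v] at either end of the stack gives the same result, so the stack consists of
   copies of that sign. *)
rewrite pile_cat !ffunE eqxx /= => /rcons_cons_constant sv.
apply: pile_signs_special.
by apply/negP => /(allP sv).
Qed.

(** Without triangles, the stars of adjacent [v] and [w] meet only in [v] and [w]. *)
Lemma centralizer_edge v w c : triangle_free G -> adj v w ->
  commute c (gen v) -> commute c (gen w) ->
  exists (m n : int), c = zpow (gen w) n * zpow (gen v) m.
Proof.
move=> tf vw /centralizer_gen cv /centralizer_gen cw; apply: (special_edge vw).
rewrite (_ : [set v; w] = st v :&: st w)%SET; first exact: special_setI.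
apply/setP => u; rewrite !inE.
case: (eqVneq u v) => [->|uv] /=; first by rewrite adj_sym vw orbT.
case: (eqVneq u w) => [->|uw] /=; first by rewrite vw.
by apply/esym/negbTE; have := tf v w u; rewrite vw [adj u v]adj_sym /= andbC.
Qed.

End Pilings.

(** * Maximal joins and V0 *)

Section Components.
Variable G : sgraph.
Implicit Types (v w x y : G) (S T C : {set G}).

Definition comp_of S x :=
  [set y in S | connect [rel v w | [&& v \in S, w \in S & adj v w]] x y]%SET.

Lemma componentsP S C :
  reflect (exists2 x, x \in S & C = comp_of S x) (C \in components S).
Proof. exact: imsetP. Qed.

Lemma comp_of_id S x : x \in S -> x \in comp_of S x.
Proof. by move=> xS; rewrite inE xS connect0. Qed.

Lemma comp_of_sub S x : comp_of S x \subset S.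
Proof. by apply/fintype.subsetP => y; rewrite inE => /andP[]. Qed.

Lemma comp_of_adj S x y z :
  y \in comp_of S x -> adj y z -> z \in S -> z \in comp_of S x.
Proof.
rewrite !inE => /andP[yS xy] yz zS; rewrite zS; apply: connect_trans xy _.
by apply: connect1; rewrite /= yS zS.
Qed.

Lemma comp_of_min S T x : x \in T ->
  (forall y z, y \in T -> y \in S -> z \in S -> adj y z -> z \in T) ->
  comp_of S x \subset T.
Proof.
move=> xT TT; apply/fintype.subsetP => y; rewrite inE => /andP[_ /connectP[p + ->]].
elim: p x xT => //= z p ih x xT /andP[/and3P[xS zS xz]].
by apply: ih; apply: TT xz.
Qed.

Lemma comp_of_eq S x y : y \in comp_of S x -> comp_of S y = comp_of S x.
Proof.
have sym : connect_sym [rel v w | [&& v \in S, w \in S & adj v w]].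
  apply: sym_connect_sym => v w /=.
  by rewrite adj_sym andbCA.
rewrite inE => /andP[_ xy]; apply/setP => z; rewrite !inE; congr (_ && _).
by apply/idP/idP; apply: connect_trans; rewrite // sym.
Qed.

Lemma components_eq S C x : C \in components S -> x \in C -> C = comp_of S x.
Proof. by case/componentsP=> y _ -> /comp_of_eq ->. Qed.

Lemma components_sub S C : C \in components S -> C \subset S.
Proof. by case/componentsP=> x _ ->; apply: comp_of_sub. Qed.

Lemma components_adj S C y z :
  C \in components S -> y \in C -> adj y z -> z \in S -> z \in C.
Proof. by case/componentsP=> x _ ->; apply: comp_of_adj. Qed.

Lemma components_inh S C : C \in components S -> exists x, x \in C.
Proof. by case/componentsP=> x xS ->; exists x; apply: comp_of_id. Qed.

Lemma components_meet S C D x :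
  C \in components S -> D \in components S -> x \in C -> x \in D -> C = D.
Proof. by move=> /components_eq CE /components_eq DE /CE-> /DE->. Qed.

Lemma connected_ind T x : graph_connected G -> x \in T ->
  (forall y z, y \in T -> adj y z -> z \in T) -> forall z, z \in T.
Proof.
move=> conn xT TT z; have /connectP[p + ->] := conn x z.
elim: p x xT => //= u p ih x xT /andP[xu]; apply: ih; exact: TT xu.
Qed.

End Components.

Section Links.
Variable G : sgraph.
Implicit Types (v w x y : G) (S T C : {set G}).

Lemma lk_sym v w : (w \in lk v) = (v \in lk w).
Proof. by rewrite !inE adj_sym. Qed.

Lemma tf_adj v w u : triangle_free G -> adj v w -> adj v u -> ~~ adj w u.
Proof.
move=> tf vw vu; have := tf v w u.
by rewrite vw [adj u v]adj_sym vu andbT.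
Qed.

(** A neighbour of [v] lies in the star of no other neighbour of [v], as this would close a
    triangle. So [lk_perp v] avoids the link of [v], and stars may be replaced by links. *)
Lemma lk_perpP v x : triangle_free G -> (1 < #|lk v|)%N ->
  (x \in lk_perp v) = (lk v \subset lk x).
Proof.
move=> tf lk2; apply/bigcapP/fintype.subsetP => [xv|vx y /vx]; last first.
  by rewrite !inE adj_sym => ->; rewrite orbT.
have xNv : x \notin lk v.
  apply/negP => vx; have /card_gt1P[y [z [yv zv yz]]] := lk2.
  have [u uv ux] : exists2 u, u \in lk v & u != x.
    by case: (eqVneq y x) => [yx|yx]; [exists z; rewrite // -yx eq_sym|exists y].
  have := xv u uv; rewrite !inE [x == u]eq_sym (negPf ux) /=; apply/negP.
  by apply: (@tf_adj v) => //; [move: uv|move: vx]; rewrite inE.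
move=> y yv; have := xv y yv; rewrite !inE [adj x y]adj_sym.
by case: eqP => // xy; rewrite xy yv in xNv.
Qed.

Lemma mem_join v x : triangle_free G -> (1 < #|lk v|)%N ->
  (x \in join_of v) = adj v x || (lk v \subset lk x).
Proof. by move=> tf lk2; rewrite inE lk_perpP // inE. Qed.

Lemma join_center v : triangle_free G -> (1 < #|lk v|)%N -> v \in join_of v.
Proof. by move=> tf lk2; rewrite mem_join // subxx orbT. Qed.

Lemma lk_join v x : adj v x -> x \in join_of v.
Proof. by move=> vx; rewrite !inE vx. Qed.

Lemma edgesP (E : {set G}) :
  reflect (exists x y, adj x y /\ E = [set x; y]%SET) (E \in edges G).
Proof.
apply: (iffP imsetP) => [[[x y] /=]|[x [y [xy ->]]]].
  by rewrite inE /= => xy ->; exists x, y.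
by exists (x, y); rewrite ?inE.
Qed.

Lemma connected_lk v : graph_connected G -> (0 < #|edges G|)%N -> (0 < #|lk v|)%N.
Proof.
move=> conn /card_gt0P[E /edgesP[x [y [xy _]]]]; rewrite card_gt0.
apply/negP => /eqP lk0.
have vT z : z \in [set v]%SET.
  apply: (connected_ind conn (set11 v)) => a b; rewrite !inE => /eqP-> vb.
  by have : b \in lk v; [rewrite inE|rewrite lk0 inE].
by move: (vT x) (vT y) xy; rewrite !inE => /eqP-> /eqP->; rewrite adj_irr.
Qed.

(** Every edge passes through the centre and is determined by its other end. This provides the
    centre of a star with two neighbours. *)
Lemma star_lk c : triangle_free G -> st c = [set: G]%SET ->
  (#|edges G| <= #|lk c|)%N.
Proof.
move=> tf stc; have cadj x : x != c -> adj c x.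
  by move=> xc; have := finset.in_setT x; rewrite -stc !inE (negPf xc).
have sub : edges G \subset [set [set c; u]%SET | u in lk c]%SET.
  apply/fintype.subsetP => E /edgesP[x [y [xy ->]]]; apply/imsetP.
  case: (eqVneq x c) => [xc|xc]; first by exists y; rewrite ?inE -?xc.
  case: (eqVneq y c) => [yc|yc].
    by exists x; rewrite ?inE -?yc 1?adj_sym // finset.setUC.
  by have := tf_adj tf (cadj x xc) (cadj y yc); rewrite xy.
exact: leq_trans (subset_leq_card sub) (leq_imset_card _ _).
Qed.

Lemma interior_lk v : graph_connected G -> (0 < #|edges G|)%N ->
  interior v -> (1 < #|lk v|)%N.
Proof.
by move=> conn /(connected_lk v conn); rewrite /interior /leaf; case: #|_| => [|[]].
Qed.

End Links.

Section V0.
Variables (G : sgraph) (V0 : {set G}).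
Hypotheses (conn : graph_connected G) (tf : triangle_free G)
  (e2 : (1 < #|edges G|)%N) (nstar : ~~ is_star G) (V0P : is_V0 V0).

Let V0max v : v \in V0 -> maximal_class v.
Proof. by move: V0P; rewrite /is_V0 (negPf nstar) => -[+ _] => /[apply]. Qed.

Let V0card u : maximal_class u -> #|[set v in V0 | lk v == lk u]%SET| = 1%N.
Proof. by move: V0P; rewrite /is_V0 (negPf nstar) => -[_]; apply. Qed.

Lemma V0_lk v : v \in V0 -> (1 < #|lk v|)%N.
Proof. by case/V0max=> iv _; apply: interior_lk => //; apply: ltnW. Qed.

(** Maximality turns the inclusion into an equality, and each class has one representative. *)
Lemma V0_antichain v w : v \in V0 -> w \in V0 -> lk v \subset lk w -> v = w.
Proof.
move=> v0 w0 vw; have [[iv vmax] wm] := (V0max v0, V0max w0).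
have /eqP/cards1P[x xE] := V0card wm.
have := vmax w wm.1 vw => wv.
have : v \in [set x]%SET by rewrite -xE !inE v0 wv eqxx.
have : w \in [set x]%SET by rewrite -xE !inE w0 eqxx.
by rewrite !inE => /eqP-> /eqP->.
Qed.

(* A leaf attached at y is dominated by any interior neighbour of y, and one
   exists because the graph is not a star. *)
Lemma V0_cover x : exists2 v, v \in V0 & lk x \subset lk v.
Proof.
have [y iy xy] : exists2 y, interior y & lk x \subset lk y.
  have [ix|/negPn/cards1P[y yE]] := boolP (interior x); first by exists x.
  have yx : adj y x by rewrite adj_sym; have := set11 y; rewrite -yE inE.
  have [[z [yz iz]]|no] := pselect (exists z, adj y z /\ interior z).
    by exists z; rewrite // yE finset.sub1set inE adj_sym.
  (* If all neighbours of [y] are leaves, connectedness forces the whole graph into [st y]. *)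
  case/negP: nstar; apply/existsP; exists y; apply/eqP/setP => u.
  rewrite [RHS]inE.
  apply: (connected_ind conn (x := y)); first by rewrite !inE eqxx.
  move=> a b; rewrite !inE => /orP[/eqP->|ya] ab; first by rewrite ab orbT.
  have /cards1P[z zE] : leaf a.
    by apply: contrapT => /negP ia; apply: no; exists a.
  have : y \in lk a by rewrite inE adj_sym.
  have : b \in lk a by rewrite inE.
  by rewrite zE !inE => /eqP-> /eqP->; rewrite eqxx.
(* Among the interior vertices dominating [x], one with a largest link has a maximal class. *)
pose P z := interior z && (lk x \subset lk z).
have Py : P y by rewrite /P iy.
have [w /andP[iw xw] wmax] := arg_maxnP (fun z => #|lk z|) Py.
have mw : maximal_class w.
  split=> // z iz wz; apply/esym/eqP; rewrite eqEcard wz.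
  by apply: wmax; rewrite /P iz (fintype.subset_trans xw).
have /eqP/cards1P[v vE] := V0card mw.
have : v \in [set v in V0 | lk v == lk w]%SET by rewrite vE inE.
by rewrite inE => /andP[v0 /eqP vw]; exists v; rewrite ?vw.
Qed.

End V0.

(** * Conjugations on unions of components *)

Lemma zpow_additive (A : groupType) (g : int -> A) :
  (forall m n, g (m + n)%R = g m * g n) -> forall n, g n = zpow (g 1%R) n.
Proof.
move=> gD; have g0 : g 0%R = 1 by apply: (mulgI (g 0%R)); rewrite -gD addr0 mulg1.
elim=> [|k ih|k ih]; first by rewrite g0.
  by rewrite -addn1 PoszD gD zpowD ih zpow1.
rewrite -addn1 PoszD opprD gD zpowD ih; congr (_ * _).
by rewrite zpowN zpow1; apply: (mulgI (g 1%R)); rewrite -gD subrr mulgV.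
Qed.

Section PartialConjugations.
Variable G : sgraph.
Implicit Types (v w x y u : G) (S T C : {set G}) (a b : raag G)
  (f : aut (raag G)).

(** A condition ensuring that conjugating [S] by [v] respects the commutation relations. It covers
    the components of Gamma - st v, which define partial conjugations, as well as those of Gamma -
    v. *)
Definition conj_compatible v S := forall x y,
  adj x y -> x \in S -> [|| y \in S, y \in st v | x \in st v].

(* The sets closed under adjacency away from [v] are the unions of components
   of the complement of [v]. *)
Definition closed_away v S :=
  v \notin S /\ forall x y, x \in S -> adj x y -> y != v -> y \in S.

Lemma closed_away_compatible v S : closed_away v S -> conj_compatible v S.
Proof.
move=> [_ SP] x y xy xS; case: (eqVneq y v) => [->|yv].
  by rewrite !inE eqxx orbT.
by rewrite (SP x).
Qed.

Lemma component_closed_away v C :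
  C \in components (~: [set v])%SET -> closed_away v C.
Proof.
move=> Cv; split=> [|x y xC xy yv]; last first.
  by apply: components_adj Cv xC xy _; rewrite !inE.
by apply/negP => /(fintype.subsetP (components_sub Cv)); rewrite !inE eqxx.
Qed.

Lemma closed_away_compl v S :
  closed_away v S -> closed_away v (~: (v |: S))%SET.
Proof.
move=> [vS SP]; split=> [|x y]; first by rewrite !inE eqxx.
rewrite !inE !negb_or => /andP[xv xS] xy yv; rewrite yv.
by apply: contra xS => yS; apply: SP yS _ xv; rewrite adj_sym.
Qed.

Lemma gen_st_commute v x : x \in st v -> commute (gen x) (gen v).
Proof. by rewrite !inE => /orP[/eqP->|] //; rewrite adj_sym => /gen_commute. Qed.

Lemma gen_st_conj v x n : x \in st v -> gen x ^ zpow (gen v) n = gen x.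
Proof. by move=> /gen_st_commute xv; apply/commute_conjg/commute_zpow. Qed.

Section PartialConj.
Variables (v : G) (S : {set G}) (vS : conj_compatible v S).

Definition pc_gen n x := if x \in S then gen x ^ zpow (gen v) n else gen x.

Lemma pc_gen_comm n x y : adj x y -> commute (pc_gen n x) (pc_gen n y).
Proof.
have half u w : adj u w -> u \in S -> w \notin S ->
    commute (gen u ^ zpow (gen v) n) (gen w).
  move=> uw uS wS; have := vS uw uS; rewrite (negPf wS) /=.
  case/orP=> [wv|uv]; last by rewrite gen_st_conj //; apply: gen_commute.
  rewrite -(gen_st_conj n wv) /commute -!conjMg; congr (_ ^ _).
  exact: gen_commute.
move=> xy; rewrite /pc_gen; case: ifPn => xS; case: ifPn => yS.
- by rewrite /commute -!conjMg; congr (_ ^ _); apply: gen_commute.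
- exact: half.
- by apply/commute_sym/half; rewrite // adj_sym.
- exact: gen_commute.
Qed.

Definition pc_hom n := raag_hom (@pc_gen_comm n).

Lemma pc_hom_gen n x : pc_hom n (gen x) = pc_gen n x.
Proof. exact: raag_hom_gen. Qed.

Lemma pc_hom_center n : pc_hom n (gen v) = gen v.
Proof.
by rewrite pc_hom_gen /pc_gen; case: ifP => // _; rewrite gen_st_conj // !inE eqxx.
Qed.

Lemma pc_homD m n a : pc_hom m (pc_hom n a) = pc_hom (m + n)%R a.
Proof.
apply: (raag_hom_eq (f := pc_hom m \o pc_hom n)) => y /=.
rewrite !pc_hom_gen /pc_gen; case: ifP => yS; last by rewrite pc_hom_gen /pc_gen yS.
rewrite gmulfJ gmulf_zpow pc_hom_center pc_hom_gen /pc_gen yS.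
by rewrite -conjgM -zpowD.
Qed.

Lemma pc_hom0 a : pc_hom 0 a = a.
Proof.
apply: (raag_hom_eq (g := idfun)) => y.
by rewrite pc_hom_gen /pc_gen conjg1 if_same.
Qed.

Fact pc_subproof n : {f : aut (raag G) | f =1 pc_hom n}.
Proof.
suff pc_is_aut : is_aut (pc_hom n) by exists (Aut pc_is_aut).
apply/asboolP; split; last exact: gmulfM.
by exists (pc_hom (- n)%R) => a; rewrite pc_homD ?addNr ?subrr pc_hom0.
Qed.

Definition pc n : aut (raag G) := sval (pc_subproof n).

Lemma pc_pc_hom n a : pc n a = pc_hom n a.
Proof. exact: (svalP (pc_subproof n)). Qed.

Lemma pcE n x : pc n (gen x) = if x \in S then gen x ^ zpow (gen v) n else gen x.
Proof. by rewrite pc_pc_hom pc_hom_gen. Qed.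

Lemma pc_center n : pc n (gen v) = gen v.
Proof. by rewrite pc_pc_hom pc_hom_center. Qed.

Lemma pcD m n : pc (m + n)%R = pc m * pc n.
Proof. by apply: aut_eqP => a; rewrite aut_mulgE !pc_pc_hom pc_homD. Qed.

Lemma pc_zpow n : pc n = zpow (pc 1%R) n.
Proof. exact: zpow_additive pcD n. Qed.

Lemma pc_conj_on : conj_on v S (pc 1%R).
Proof. by move=> x; rewrite pcE zpow1. Qed.

Lemma conj_on_pc f : conj_on v S f -> f = pc 1%R.
Proof. by move=> fE; apply: aut_raag_eq => x; rewrite fE pcE zpow1. Qed.

End PartialConj.

Lemma pc_setD v S T n (vS : conj_compatible v S) (vT : conj_compatible v T)
    (vD : conj_compatible v (S :\: T)%SET) :
  T \subset S -> pc vS n = pc vT n * pc vD n.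
Proof.
move=> TS; apply: aut_raag_eq => x; rewrite aut_mulgE !pcE !inE.
case xT: (x \in T) => /=; first by rewrite (fintype.subsetP TS) // pcE xT.
case: ifP => xS; last by rewrite pcE xT.
by rewrite aut_conj aut_zpow pc_center pcE xT.
Qed.

Lemma Aut0_gen f : aut0_generator f -> Aut0 f.
Proof. by move=> af; apply: gen_subgroup_sub. Qed.

Lemma Aut0_conj a : Aut0 (conj_aut a : aut (raag G)).
Proof. by apply: Aut0_gen; apply: aut0_inner; exists a. Qed.

(** Components of Gamma - st v are peeled off [S] one at a time, each giving a partial conjugation.
    What is left lies in [st v] and commutes with [v]. *)
Lemma Aut0_conj_on v S f : conj_compatible v S -> conj_on v S f -> Aut0 f.
Proof.
move=> vS fE; rewrite (conj_on_pc vS fE) {f fE}.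
have [k] := ubnP #|S :\: st v|%SET; elim: k S vS => // k ih S vS lt_S.
have [/eqP S0|] := boolP (S :\: st v == finset.set0)%SET.
  rewrite (_ : pc vS 1%R = 1); first exact: gen_subgroup1.
  apply: aut_raag_eq => x; rewrite pcE; case: ifP => // xS.
  apply: gen_st_conj; apply/negPn/negP => xv.
  by have : x \in (S :\: st v)%SET; [rewrite finset.in_setD xv|rewrite S0 inE].
case/finset.set0Pn => x; rewrite finset.in_setD => /andP[xv xS].
pose C := comp_of (~: st v)%SET x.
have CC : C \in components (~: st v)%SET.
  by apply/componentsP; exists x; rewrite // finset.in_setC.
have CS : C \subset S.
  apply: comp_of_min xS _ => y z yS yv zv yz; have := vS y z yz yS.
  by move: yv zv; rewrite !finset.in_setC => /negPf-> /negPf->; rewrite !orbF.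
have vC : conj_compatible v C.
  move=> y z yz yC; case zv: (z \in st v); first by rewrite orbT.
  by rewrite (components_adj CC yC yz) // finset.in_setC zv.
have vD : conj_compatible v (S :\: C)%SET.
  move=> y z yz; rewrite !finset.in_setD => /andP[yC yS].
  case/or3P: (vS y z yz yS) => [zS|->|->]; rewrite ?orbT // zS andbT.
  case yv: (y \in st v); rewrite ?orbT // orbF; apply/orP; left.
  apply: contra yC => zC; apply: (components_adj CC zC); first by rewrite adj_sym.
  by rewrite finset.in_setC yv.
rewrite (pc_setD _ vS vC vD CS); apply: gen_subgroupM.
  by apply: Aut0_gen; apply: (aut0_partial_conj CC); apply: pc_conj_on.
apply: ih; rewrite ltnS in lt_S; apply: leq_trans lt_S.
apply: proper_card; apply/fintype.properP; split.
  by apply/fintype.subsetP => y; rewrite !finset.in_setD => /and3P[-> _ ->].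
exists x; rewrite !finset.in_setD ?xv ?xS //.
by rewrite comp_of_id ?andbF // finset.in_setC.
Qed.

End PartialConjugations.

(** * Restriction to a join *)

Section ActionOnJoins.
Variable G : sgraph.
Implicit Types (v w u : G) (S T C J : {set G}) (a b : raag G)
  (f : aut (raag G)).

Definition conj_on_special J f :=
  exists a, forall x, special_subgroup J x -> f x = x ^ a.

(** The equivalence, rather than an implication, makes the property stable under inverses. *)
Definition preserves_special J f :=
  exists a, forall x, special_subgroup J x <-> special_subgroup J (f x ^ a).

Lemma conj_on_special_gen J f a :
  (forall u, u \in J -> f (gen u) = gen u ^ a) -> conj_on_special J f.
Proof.
move=> fE; exists a.
exact: (special_morph_eq (f := f) (g := conj_aut a)).
Qed.

Lemma conj_on_special1 J : conj_on_special J 1.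
Proof. by exists 1 => x _; rewrite conjg1. Qed.

Lemma conj_on_specialM J f g :
  conj_on_special J f -> conj_on_special J g -> conj_on_special J (f * g).
Proof.
move=> [a fa] [b gb]; exists (a * f b) => x xJ.
by rewrite aut_mulgE gb // aut_conj fa // conjgM.
Qed.

Lemma conj_on_specialV J f : conj_on_special J f -> conj_on_special J f^-1.
Proof.
move=> [a fa]; exists (f^-1 a)^-1 => x xJ.
by apply: (can_inj (conjgK (f^-1 a))); rewrite conjgKV -aut_conj -fa // aut_invgKV.
Qed.

Lemma conj_on_special_zpow J f n :
  conj_on_special J f -> conj_on_special J (zpow f n).
Proof.
move=> fJ; have fX k : conj_on_special J (f ^+ k).
  elim: k => [|k ih]; first exact: conj_on_special1.
  by rewrite expgS; apply: conj_on_specialM.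
by case: n => k; [apply: fX|apply: conj_on_specialV (fX k.+1)].
Qed.

Lemma conj_on_special_conj J a : conj_on_special J (conj_aut a).
Proof. by exists a. Qed.

(* In a join [J], any two vertices of a side have common neighbours on the
   other side, so [J] minus a vertex [w] other than the centre [v] is
   connected. *)
Lemma conj_on_special_pc v w S f : triangle_free G -> (1 < #|lk v|)%N ->
  closed_away w S -> conj_on w S f -> conj_on_special (join_of v) f.
Proof.
move=> tf lk2 [wS SP] fE.
have side x y z : x \in S -> adj x z -> adj y z -> z != w -> y != w -> y \in S.
  by move=> xS xz yz zw yw; apply: (SP z) => //; [apply: SP xz zw|rewrite adj_sym].
(* The vertices of the join on which the conjugation by [w] is visible. If there is one, all
   vertices of the join outside [st w] are in [S] and [f] conjugates the join by [w]; otherwise [f]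
   is the identity on it. *)
pose moved x := [&& x \in join_of v, x \in S & x \notin st w].
have all_moved x y : moved x -> y \in join_of v -> y \notin st w -> y \in S.
  case/and3P; rewrite !mem_join // => xJ xS; rewrite !inE !negb_or => /andP[xw wx].
  move=> yJ /andP[yw wy].
  case/orP: xJ => [vx|vx]; case/orP: yJ => [vy|vy].
  - apply: (side x y v) => //; rewrite 1?adj_sym //.
    by apply: contraNneq wx => <-.
  - apply: SP xS _ yw; rewrite adj_sym.
    by move/fintype.subsetP: vy => /(_ x); rewrite !inE; apply.
  - apply: SP xS _ yw.
    by move/fintype.subsetP: vx => /(_ y); rewrite !inE; apply.
  - have [z zv zw] : exists2 z, z \in lk v & z != w.
      have /card_gt1P[z1 [z2 [z1v z2v z12]]] := lk2.
      case: (eqVneq z1 w) => [z1w|z1w]; last by exists z1.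
      by exists z2; rewrite // -z1w eq_sym.
    apply: (side x y z) => //.
      by move/fintype.subsetP: vx => /(_ z zv); rewrite inE.
    by move/fintype.subsetP: vy => /(_ z zv); rewrite inE.
have [/existsP[x mx]|] := boolP [exists x, moved x].
  apply: (conj_on_special_gen (a := gen w)) => u uJ; rewrite fE.
  case uw: (u \in st w).
    by have := gen_st_conj 1%R uw; rewrite zpow1 => ->; case: ifP.
  by rewrite (all_moved x) // uw.
move/existsPn=> nm; apply: (conj_on_special_gen (a := 1)) => u uJ.
rewrite fE conjg1; case: ifP => // uS.
have := nm u; rewrite /moved uJ uS /= negbK => uw.
by have := gen_st_conj 1%R uw; rewrite zpow1.
Qed.

Lemma preserves_special1 J : preserves_special J 1.
Proof. by exists 1 => x; rewrite conjg1. Qed.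

Lemma preserves_specialM J f g :
  preserves_special J f -> preserves_special J g -> preserves_special J (f * g).
Proof.
move=> [a fa] [b gb]; exists (f b * a) => x.
by rewrite aut_mulgE conjgM -aut_conj; split=> [/(gb _).1/(fa _).1|/(fa _).2/(gb _).2].
Qed.

Lemma preserves_specialV J f : preserves_special J f -> preserves_special J f^-1.
Proof.
move=> [a fa]; exists (f^-1 a^-1) => x; rewrite -aut_conj.
have := fa (f^-1 (x ^ a^-1)); rewrite aut_invgK conjgKV => H.
by split=> [/H.2|/H.1].
Qed.

Lemma conj_preserves_special J f : conj_on_special J f -> preserves_special J f.
Proof.
move=> [a fa]; exists a^-1 => x; split=> [xJ|fx]; first by rewrite fa // conjgK.
have : f (f x ^ a^-1) = f x by rewrite fa // conjgKV.
by move/(bij_inj (autP f).1) <-.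
Qed.

Lemma preserves_special_gen J f :
  (forall u, u \in J -> special_subgroup J (f (gen u))) ->
  (forall u, u \in J -> exists2 x, special_subgroup J x & f x = gen u) ->
  preserves_special J f.
Proof.
move=> fJ Jf; exists 1 => x; rewrite conjg1; split.
  move: x; apply: special_ind => //; first by rewrite aut1; apply: special1.
  - by move=> x y; rewrite autM; apply: specialM.
  - by move=> x; rewrite autV; apply: specialV.
move=> fx; have [y yJ yx] : exists2 y, special_subgroup J y & f y = f x.
  move: (f x) fx; apply: special_ind => //.
  - by exists 1; [apply: special1|rewrite aut1].
  - move=> _ _ [a aJ <-] [b bJ <-].
    by exists (a * b); [apply: specialM|rewrite autM].
  - by move=> _ [a aJ <-]; exists a^-1; [apply: specialV|rewrite autV].
by move/(bij_inj (autP f).1): yx <-.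
Qed.

(** It is enough to treat the generators of Aut^0: each maps A_J to itself or acts on it as a
    conjugation. *)
Lemma Aut0_preserves_join v f : triangle_free G -> (1 < #|lk v|)%N ->
  Aut0 f -> preserves_special (join_of v) f.
Proof.
move=> tf lk2; move: f; apply: gen_subgroup_ind.
- exact: preserves_special1.
- exact: preserves_specialM.
- exact: preserves_specialV.
move=> f [[a fa]|w fE|w C Cw fE|w x wx xw fE].
- by apply: conj_preserves_special; exists a => x _.
- apply: preserves_special_gen => u uJ.
    rewrite fE; case: eqP => [<-|_]; last exact: special_gen.
    by apply: specialV; apply: special_gen.
  case: (eqVneq u w) => [uw|uw].
    exists (gen u)^-1; first by apply: specialV; apply: special_gen.
    by rewrite autV fE uw eqxx invgK.
  by exists (gen u); [apply: special_gen|rewrite fE (negPf uw)].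
- have [wJ|wJ] := boolP (w \in join_of v).
    have fw : f (gen w) = gen w.
      by rewrite fE; case: ifP => // _; rewrite /conjg mulgA mulVg mul1g.
    apply: preserves_special_gen => u uJ.
      by rewrite fE; case: ifP => _; [apply: gen_subgroupJ|]; apply: special_gen.
    case uC: (u \in C); last by exists (gen u); [apply: special_gen|rewrite fE uC].
    exists (gen u ^ (gen w)^-1).
      by apply: gen_subgroupJ; [|apply: specialV]; apply: special_gen.
    by rewrite aut_conj autV fw fE uC conjgK.
  (* Now [w] is outside the join, whose vertices outside [st w] lie in a single component of Gamma -
     st w. So [f] is on A_J the conjugation by [w] or the identity. *)
  apply: conj_preserves_special.
  move: wJ; rewrite mem_join // negb_or => /andP[vw vNw].
  have step y z : y \in C -> adj y z -> z \notin st w -> z \in C.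
    by move=> yC yz zw; apply: (components_adj Cw yC yz); rewrite finset.in_setC.
  have vst : v \notin st w.
    rewrite !inE negb_or [adj w v]adj_sym vw andbT.
    by apply: contraNneq vNw => ->.
  have same y z : y \in C -> y \in join_of v -> z \in join_of v ->
      z \notin st w -> z \in C.
    rewrite !mem_join // => yC yJ zJ zw.
    case/orP: yJ => [vy|vy]; case/orP: zJ => [vz|vz].
    + apply: (step v) => //; apply: (step y) => //; by rewrite adj_sym.
    + apply: (step y) => //; rewrite adj_sym.
      by move/fintype.subsetP: vz => /(_ y); rewrite !inE; apply.
    + apply: (step y) => //.
      by move/fintype.subsetP: vy => /(_ z); rewrite !inE; apply.
    (* Two vertices whose links contain [lk v] are connected through a neighbour of [v] that is not
       a neighbour of [w]. *)
    + have /subsetPn[t tv tw] := vNw.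
      have yt : adj y t.
        by move/fintype.subsetP: vy => /(_ t tv); rewrite inE.
      have zt : adj z t.
        by move/fintype.subsetP: vz => /(_ t tv); rewrite inE.
      apply: (step t) => //; last by rewrite adj_sym.
      apply: (step y) => //; rewrite in_setU1 (negPf tw) orbF.
      by apply: contraNneq vw => <-; move: tv; rewrite inE.
  have [/existsP[y /andP[yJ yC]]|] := boolP [exists y, (y \in join_of v) && (y \in C)].
    apply: (conj_on_special_gen (a := gen w)) => u uJ; rewrite fE.
    case uw: (u \in st w); last by rewrite (same y) // uw.
    by have := gen_st_conj 1%R uw; rewrite zpow1 => ->; case: ifP.
  move/existsPn=> nm; apply: (conj_on_special_gen (a := 1)) => u uJ.
  by rewrite fE conjg1; have := nm u; rewrite uJ => /= /negPf->.
- have [xJ|xJ] := boolP (x \in join_of v); last first.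
    apply/conj_preserves_special/(conj_on_special_gen (a := 1)) => u uJ.
    by rewrite fE conjg1; case: eqP => // ux; rewrite ux (negPf xJ) in uJ.
  (* If [x] is adjacent to [v], then [v] is in [lk x], hence in [st w]. Otherwise [lk v] is
     contained in [lk x], hence in [st w]. *)
  have wJ : w \in join_of v.
    move: xJ; rewrite !mem_join // => /orP[vx|vx].
      have : v \in st w by apply: (fintype.subsetP xw); rewrite inE adj_sym.
      rewrite !inE => /orP[/eqP->|]; first by rewrite subxx orbT.
      by rewrite adj_sym => ->.
    case vw: (adj v w) => //=; apply/fintype.subsetP => t tv.
    have := fintype.subsetP xw t (fintype.subsetP vx t tv).
    rewrite !inE => /orP[/eqP tw|//].
    by move: tv; rewrite tw inE vw.
  have fw : f (gen w) = gen w by rewrite fE (negPf wx).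
  apply: preserves_special_gen => u uJ.
    rewrite fE; case: eqP => _; last exact: special_gen.
    by apply: specialM; apply: special_gen.
  case: (eqVneq u x) => [ux|ux].
    exists (gen u / gen w); last by rewrite autM autV fw fE ux eqxx mulgK.
    by apply: specialM; [|apply: specialV]; apply: special_gen.
  by exists (gen u); [apply: special_gen|rewrite fE (negPf ux)].
Qed.

End ActionOnJoins.

Section Restriction.
Variables (G : sgraph).
Implicit Types (v : G) (J V : {set G}) (f : aut (raag G)).
Local Open Scope classical_set_scope.

Lemma specialP J (x : special J) : special_subgroup J (val x).
Proof. exact/set_mem/(valP x). Qed.

Lemma restricts_to_exists J f : Aut0 f -> preserves_special J f ->
  exists p, restricts_to (S := J) (out_class f) p.
Proof.
(* An inner automorphism corrects [f] so that it maps A_J onto itself. *)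
move=> f0 [a fa]; pose h := conj_aut a * f.
have hJ x : special_subgroup J x <-> special_subgroup J (h x) by exact: fa.
have hVJ (x : special J) : special_subgroup J (h^-1 (val x)).
  by apply/hJ; rewrite aut_invgK; apply: specialP.
pose g (x : special J) : special J := Special (mem_set ((hJ _).1 (specialP x))).
pose g' (x : special J) : special J := Special (mem_set (hVJ x)).
have g_aut : is_aut g.
  apply/asboolP; split.
    exists g' => x; apply/val_inj.
      exact: (aut_invgKV h (val x)).
    exact: (aut_invgK h (val x)).
  by move=> x y; apply/val_inj; rewrite valM; apply: (autM h (val x) (val y)).
exists (out_class (Aut g_aut)); exists h, (Aut g_aut); split=> //.
  by apply: gen_subgroupM f0; apply: Aut0_conj.
by rewrite -[out_class h]out_mulE out_class_conj out_mul1.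
Qed.

(* The retraction onto [A_J] turns a conjugation preserving [A_J] into a
   conjugation by an element of [A_J]. *)
Lemma restricts_to_conj J f p : conj_on_special J f ->
  restricts_to (S := J) (out_class f) p -> p = 1.
Proof.
move=> [a fa] [h [g [h0 /out_classP[b hf] gh <-]]].
apply/out_class1P; have rJ := @retract_in _ J (a * b).
exists (Special (mem_set rJ)) => x; apply/val_inj.
have -> : val (x ^ Special (mem_set rJ)) = val x ^ retract J (a * b).
  exact: gmulfJ.
have gx : val (g x) = val x ^ (a * b).
  by rewrite gh hf (fa _ (specialP x)) conjgM.
by rewrite -(retract_id (specialP (g x))) gx gmulfJ (retract_id (specialP x)).
Qed.

Lemma restriction_trivialP J f : Aut0 f -> preserves_special J f ->
  restriction J (out_class f) = 1 <-> conj_on_special J f.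
Proof.
move=> f0 fJ; rewrite /restriction; split=> [r1|fc]; last first.
  by case: xgetP => // p _; apply: restricts_to_conj.
have [p rp] := restricts_to_exists f0 fJ.
(* Some class is a restriction, so the value 1 is a genuine restriction and not merely the default
   of [xget]. *)
have := xgetPex (1 : out (special J)) (ex_intro _ p rp).
rewrite /= in r1 *; rewrite r1 => -[h [g [h0 /out_classP[b hf] gh /out_class1P[c gc]]]].
exists (val c * b^-1) => x xJ.
have /(congr1 (conjg^~ b^-1)) /= := hf x; rewrite conjgK => <-.
rewrite -[x in h x]/(val (Special (mem_set xJ))) -gh gc conjgM.
by congr (_ ^ _); apply: gmulfJ.
Qed.

Lemma K0P (V : {set G}) (o : out (raag G)) : triangle_free G ->
  (forall v, v \in V -> (1 < #|lk v|)%N) ->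
  K0 V o <-> exists f, [/\ Aut0 f, out_class f = o &
                     forall v, v \in V -> conj_on_special (join_of v) f].
Proof.
move=> tf Vlk; split=> [[[f f0 <-] r0]|[f [f0 <- fc]]].
  exists f; split=> // v vV; apply/restriction_trivialP => //.
    by apply: Aut0_preserves_join => //; apply: Vlk.
  exact: (congr1 (fun r => r (exist _ v vV)) r0).
split; first by exists f.
apply: functional_extensionality_dep => -[v vV] /=.
apply/restriction_trivialP => //; last exact: fc.
by apply: Aut0_preserves_join => //; apply: Vlk.
Qed.

End Restriction.

(** * Generators of the kernel *)

Lemma nonleaf_conjugations_K0 (G : sgraph) (V : {set G}) (o : out (raag G)) :
  triangle_free G -> (forall v, v \in V -> (1 < #|lk v|)%N) ->
  gen_subgroup (nonleaf_conjugations G) o -> K0 V o.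
Proof.
move=> tf Vlk oN; apply/K0P => //; move: o oN; apply: gen_subgroup_ind.
- exists 1; split=> [|//|v vV]; first exact: gen_subgroup1.
  exact: conj_on_special1.
- move=> _ _ [f [f0 <- fV]] [g [g0 <- gV]]; exists (f * g).
  split=> [||v vV]; first exact: gen_subgroupM.
    exact/esym/out_mulE.
  by apply: conj_on_specialM; [apply: fV|apply: gV].
- move=> _ [f [f0 <- fV]]; exists f^-1.
  split=> [||v vV]; first exact: gen_subgroupV.
    exact/esym/out_invE.
  exact/conj_on_specialV/fV.
- move=> _ [v [C [f [_ Cv _ fE <-]]]]; exists f.
  have Cc := component_closed_away Cv.
  split=> // [|w wV]; first exact: Aut0_conj_on (closed_away_compatible Cc) fE.
  by apply: conj_on_special_pc Cc fE => //; apply: Vlk.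
Qed.

(** If [v] does not separate, the component is all of Gamma - v and the conjugation is inner. *)
Lemma out_class_pc_nonleaf (G : sgraph) (v : G) (D : {set G}) n
    (vD : conj_compatible v D) :
  D \in components (~: [set v])%SET -> #|D| != 1%N ->
  gen_subgroup (nonleaf_conjugations G) (out_class (pc vD n)).
Proof.
move=> Dv D1; have [sv|nsv] := boolP (separating v).
  rewrite pc_zpow gmulf_zpow; apply: gen_subgroup_zpow; apply: gen_subgroup_sub.
  by exists v, D, (pc vD 1%R); split=> //; apply: pc_conj_on.
suff -> : pc vD n = conj_aut (zpow (gen v) n).
  by rewrite out_class_conj; apply: gen_subgroup1.
apply: aut_raag_eq => u; rewrite pcE /=; case: ifP => // uD.
case: (eqVneq u v) => [->|uv]; first by rewrite gen_st_conj // !inE eqxx.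
case/negP: nsv; apply/card_gt1P; exists D, (comp_of (~: [set v]) u).
have uv' : u \in (~: [set v])%SET by rewrite !inE.
split=> //; first by apply/componentsP; exists u.
by apply: contraFneq uD => ->; apply: comp_of_id.
Qed.

Section Kernel.
Variables (G : sgraph) (V0 : {set G}).
Hypotheses (conn : graph_connected G) (tf : triangle_free G)
  (e2 : (1 < #|edges G|)%N) (nstar : ~~ is_star G) (V0P : is_V0 V0).
Implicit Types (v w x y z u : G) (f : aut (raag G)).

Let cover x : exists2 v, v \in V0 & lk x \subset lk v.
Proof. exact: V0_cover. Qed.

Let lk2 v : v \in V0 -> (1 < #|lk v|)%N.
Proof. exact: V0_lk. Qed.

(** A relation, because the conjugating element is not unique; it determines [k] when [x] is outside
    [st v]. *)
Definition conj_exponent f v x k :=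
  exists2 b, f (gen x) = gen x ^ b & expo v b = k.

Lemma conj_exponent_inj f v x k k' : x \notin st v ->
  conj_exponent f v x k -> conj_exponent f v x k' -> k = k'.
Proof.
move=> xv [b fb <-] [b' fb' <-]; apply: (@expo_conj_eq _ _ x); last by rewrite -fb.
by move: xv; rewrite !inE !negb_or eq_sym adj_sym.
Qed.

Section ConstantExponent.
Variable f : aut (raag G).
Hypothesis fV : forall v, v \in V0 -> conj_on_special (join_of v) f.

(** A single element conjugates all generators of the join, so its exponent serves for both
    vertices. *)
Lemma conj_exponent_join v z x y k : z \in V0 ->
  x \in join_of z -> y \in join_of z -> x \notin st v ->
  conj_exponent f v x k -> conj_exponent f v y k.
Proof.
move=> zV xJ yJ xv fx; have [a fa] := fV zV.
exists a; first by apply: fa; apply: special_gen.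
apply: conj_exponent_inj xv _ fx; exists a => //.
by apply: fa; apply: special_gen.
Qed.

(* Replacing both ends of an edge by elements of V0 dominating them gives
   again an edge, so at least one of the two lies outside the star of [v]. *)
Lemma conj_exponent_edge v x y k : adj x y -> x \notin st v -> y \notin st v ->
  conj_exponent f v x k -> conj_exponent f v y k.
Proof.
move=> xy xv yv fx; have [x' x'V xx'] := cover x; have [y' y'V yy'] := cover y.
have sub (p q r : G) : lk p \subset lk q -> adj p r -> adj q r.
  by move=> /fintype.subsetP/(_ r); rewrite !inE.
have yx : adj y x by rewrite adj_sym.
have x'y : adj x' y := sub _ _ _ xx' xy.
have y'x : adj y' x := sub _ _ _ yy' yx.
have y'x' : adj y' x' by apply: (sub y) => //; rewrite adj_sym.
have x'y' : adj x' y' by rewrite adj_sym.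
(* If [x'] is outside the star, the exponent passes from [x] to [x'] in the join of [y'], then from
   [x'] to [y] in the join of [x']. Otherwise it passes through [y']. *)
have [x'v|x'v] := boolP (x' \in st v); last first.
  apply: (conj_exponent_join (z := x') (x := x')) => //.
  - by apply: join_center => //; apply: lk2.
  - exact: lk_join.
  by apply: (conj_exponent_join (z := y') (x := x)) => //; apply: lk_join.
have y'v : y' \notin st v.
  move: x'v xv yv; rewrite !inE !negb_or => /orP[/eqP x'v _|vx' /andP[_ xv] _].
    by move/andP=> [_]; rewrite -x'v x'y.
  apply/andP; split; last by apply: tf_adj tf _ x'y'; rewrite adj_sym.
  by apply: contraNneq xv => <-.
apply: (conj_exponent_join (z := x') (x := y')) => //; try exact: lk_join.
apply: (conj_exponent_join (z := y') (x := x)) => //; first exact: lk_join.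
by apply: join_center => //; apply: lk2.
Qed.

(** The exponent is not determined at a vertex of [lk v]. There, the property propagated along paths
    is that all neighbours other than [v] have exponent [k]. *)
Lemma conj_exponent_component v w k : adj v w ->
  (forall x, adj w x -> x != v -> conj_exponent f v x k) ->
  forall u, u \in comp_of (~: [set v])%SET w -> u \notin lk v ->
  conj_exponent f v u k.
Proof.
move=> vw fw.
pose T := [set u | `[< if u \in lk v then forall x, adj u x -> x != v ->
                         conj_exponent f v x k else conj_exponent f v u k >]]%SET.
suff sub : comp_of (~: [set v]) w \subset T.
  by move=> u /(fintype.subsetP sub); rewrite inE => /asboolP + /negPf uv; rewrite uv.
apply: comp_of_min; first by rewrite inE; apply/asboolP; rewrite inE vw.
move=> y z; rewrite [y \in T]inE [z \in T]inE !finset.in_setC !finset.in_set1.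
move=> /asboolP + yv zv yz; case: ifPn => yl fy.
  apply/asboolP; rewrite ifN; first exact: fy.
  move: yl; rewrite !inE => vy; have yv' : adj y v by rewrite adj_sym.
  by apply/negP => vz; have := tf_adj tf yv' yz; rewrite vz.
have yst : y \notin st v by rewrite in_setU1 negb_or yv.
apply/asboolP; case: ifPn => zl; last first.
  by apply: conj_exponent_edge yz yst _ fy; rewrite in_setU1 negb_or zv.
(* The neighbours of [z] lie in the join of a vertex of [V0] dominating [z], so [x] inherits the
   exponent of [y]. *)
move=> x zx xv; have [z' z'V /fintype.subsetP zz'] := cover z.
apply: (conj_exponent_join (z := z') z'V _ _ yst fy); apply: lk_join.
  by have := zz' y; rewrite !inE; apply; rewrite adj_sym.
by have := zz' x; rewrite !inE; apply.
Qed.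

End ConstantExponent.

Definition fixed_joins f : {set G} :=
  [set v in V0 | `[< forall u, u \in join_of v -> f (gen u) = gen u >]]%SET.

(** Consider the vertices whose link lies in the link of some element of [T]. If no edge led from
    [T] to the rest of [V0], they would be closed under adjacency, hence all vertices, and
    [V0_antichain] would give [T = V0]. *)
Lemma V0_connected (T : {set G}) t : t \in T -> T \subset V0 -> T != V0 ->
  exists v w, [/\ v \in T, w \in V0, w \notin T & adj v w].
Proof.
move=> tT TV TnV; apply: contrapT => no; case/negP: TnV.
rewrite finset.eqEsubset TV; apply/fintype.subsetP => w wV.
pose U := [set x | [exists v in T, lk x \subset lk v]]%SET.
have : w \in U.
  apply: (connected_ind conn (x := t)).
    by rewrite inE; apply/exists_inP; exists t.
  move=> x y; rewrite !inE => /exists_inP[v vT xv] xy.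
  have [y' y'V yy'] := cover y.
  apply/exists_inP; exists y' => //; apply: contrapT => /negP y'T.
  case: no; exists v, y'; split=> //; rewrite adj_sym.
  have vy : v \in lk y.
    by have := fintype.subsetP xv y; rewrite !inE [adj y v]adj_sym; apply.
  by have := fintype.subsetP yy' v vy; rewrite inE.
rewrite inE => /exists_inP[v vT wv].
by rewrite (V0_antichain nstar V0P _ _ wv) // (fintype.subsetP TV).
Qed.

(** Each vertex has a neighbour, and belongs to the join of any element of [V0] dominating that
    neighbour. *)
Lemma fixed_joins_full f : fixed_joins f = V0 -> f = 1.
Proof.
move=> fV; apply: aut_raag_eq => x.
have [y yx] : exists y, adj y x.
  have /card_gt0P[y] := connected_lk x conn (ltnW e2).
  by rewrite inE => xy; exists y; rewrite adj_sym.
have [y' y'V yy'] := cover y.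
move: (y'V); rewrite -{1}fV inE => /andP[_ /asboolP]; apply; apply: lk_join.
by have := fintype.subsetP yy' x; rewrite !inE; apply.
Qed.

(* Two adjacent vertices v, w of V0, with [f] trivial on the join of [v]: then
   [f] is conjugation by a power of [v] on the link of [w], and composing it
   with a power of the conjugation by [v] on the component of [w] makes it
   trivial on the join of [w] as well. *)
Lemma fixed_joins_grow f v w :
  (forall z, z \in V0 -> conj_on_special (join_of z) f) ->
  v \in fixed_joins f -> w \in V0 -> adj v w ->
  exists C n (vC : conj_compatible v C),
    [/\ C \in components (~: [set v])%SET, #|C| != 1%N
      & w |: fixed_joins f \subset fixed_joins (pc vC n * f)].
Proof.
move=> fV; rewrite inE => /andP[vV /asboolP fv] wV vw.
have wv : adj w v by rewrite adj_sym.
have wv' : w != v by apply: contraTneq vw => ->; rewrite adj_irr.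
have [a fa] := fV w wV.
have fva : f (gen v) = gen v ^ a by apply: fa; apply: special_gen; apply: lk_join.
have fwa : f (gen w) = gen w ^ a.
  by apply: fa; apply: special_gen; apply: join_center => //; apply: lk2.
(* [f] fixes both [v] and [w], so the conjugator [a] commutes with both. *)
have av : commute a (gen v).
  apply/commute_sym/conjg_commute; rewrite -fva fv //.
  by apply: join_center => //; apply: lk2.
have aw : commute a (gen w).
  by apply/commute_sym/conjg_commute; rewrite -fwa fv // lk_join.
have [m [n aE]] := centralizer_edge tf vw av aw.
have flk x : adj w x -> f (gen x) = gen x ^ zpow (gen v) m.
  move=> wx; rewrite fa; last by apply: special_gen; apply: lk_join.
  have xw : x \in st w by rewrite !inE wx orbT.
  by rewrite aE conjgM (gen_st_conj n xw).
pose C := comp_of (~: [set v])%SET w.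
have wC : w \in C by apply: comp_of_id; rewrite !inE.
have CV : C \in components (~: [set v])%SET.
  by apply/componentsP; exists w; rewrite // !inE.
have vC := closed_away_compatible (component_closed_away CV).
exists C, (- m)%R, vC; split=> //.
  (* [w] has a neighbour other than [v], so its component is not a leaf. *)
  have /card_gt1P[x [y [xw yw xy]]] := lk2 wV.
  have [z zw zv] : exists2 z, z \in lk w & z != v.
    case: (eqVneq x v) => [xv|xv]; last by exists x.
    by exists y; rewrite // -xv eq_sym.
  rewrite inE in zw; have zC : z \in C.
    by apply: (components_adj CV wC zw); rewrite !inE.
  rewrite neq_ltn; apply/orP; right; apply/card_gt1P; exists w, z; split=> //.
  by apply: contraTneq zw => <-; rewrite adj_irr.
have Ck u : u \in C -> u \notin lk v -> conj_exponent f v u m.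
  apply: conj_exponent_component => // x wx _.
  exists (zpow (gen v) m); first exact: flk.
  by rewrite expo_zpow expo_gen eqxx mulr1.
apply/fintype.subsetP => t; rewrite in_setU1 !inE => /orP[/eqP->|/andP[tV /asboolP ft]].
  rewrite wV; apply/asboolP => u; rewrite mem_join ?lk2 // => /orP[wu|wu].
    rewrite aut_mulgE flk // aut_conj aut_zpow pc_center pcE.
    case: ifPn => uC; first by rewrite -conjgM -zpowD addNr conjg1.
    apply: gen_st_conj; rewrite !inE; apply/orP; left.
    apply: contraNT uC => uv; apply: (components_adj CV wC wu).
    by rewrite !inE.
  have vu : adj v u.
    by rewrite adj_sym; have := fintype.subsetP wu v; rewrite !inE; apply.
  rewrite aut_mulgE fv ?lk_join // pcE; case: ifP => // _.
  by apply: gen_st_conj; rewrite !inE vu orbT.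
rewrite tV; apply/asboolP => u ut; rewrite aut_mulgE ft // pcE.
case: ifP => // uC; have [ul|ul] := boolP (u \in lk v).
  by apply: gen_st_conj; rewrite in_setU1 ul orbT.
have uv : u != v.
  by have := fintype.subsetP (components_sub CV) u uC; rewrite !inE.
(* The exponent at [u] is [m] by constancy on the component, and 0 because [f] fixes [u]. So the
   correction is trivial in this case. *)
suff -> : m = 0%R by rewrite conjg1.
apply: conj_exponent_inj (Ck u uC ul) _; first by rewrite in_setU1 negb_or uv.
by exists 1; rewrite ?expo1 // conjg1 ft.
Qed.

Lemma conj_joins_nonleaf f :
  (forall v, v \in V0 -> conj_on_special (join_of v) f) ->
  gen_subgroup (nonleaf_conjugations G) (out_class f).
Proof.
move=> fV; have [v0 v0V] : exists v, v \in V0.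
  have /card_gt0P[E /edgesP[x _]] := ltnW e2.
  by have [v vV _] := cover x; exists v.
have [a fa] := fV v0 v0V.
(* Composing with an inner automorphism makes [f] the identity on a first join. *)
wlog v0T : f fV {a fa} / v0 \in fixed_joins f => [wl|].
  have := wl (conj_aut a^-1 * f).
  rewrite -[out_class (_ * _)]out_mulE out_class_conj out_mul1; apply.
    by move=> v vV; apply: conj_on_specialM (fV v vV); apply: conj_on_special_conj.
  rewrite inE v0V; apply/asboolP => u uJ.
  by rewrite aut_mulgE /= fa ?conjgK //; apply: special_gen.
(* Induction on the number of joins not yet fixed. *)
have [k] := ubnP #|V0 :\: fixed_joins f|%SET.
elim: k f fV v0T => // k ih f fV v0T lt_k.
have TV : fixed_joins f \subset V0.
  by apply/fintype.subsetP => x; rewrite inE => /andP[].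
case: (eqVneq (fixed_joins f) V0) => [/fixed_joins_full ->|TnV].
  exact: gen_subgroup1.
have [v [w [vT wV wT vw]]] := V0_connected v0T TV TnV.
have [C [n [vC [CV C1 sub]]]] := fixed_joins_grow fV vT wV vw.
have pcf : out_class f = (out_class (pc vC n))^-1 * out_class (pc vC n * f).
  by rewrite gmulfM mulKg.
rewrite pcf; apply: gen_subgroupM.
  by apply: gen_subgroupV; apply: out_class_pc_nonleaf.
apply: ih.
- move=> z zV; apply: conj_on_specialM (fV z zV).
  rewrite pc_zpow; apply: conj_on_special_zpow.
  apply: conj_on_special_pc (component_closed_away CV) (pc_conj_on _) => //.
  exact: lk2.
- by apply: (fintype.subsetP sub); rewrite in_setU1 v0T orbT.
- rewrite ltnS in lt_k; apply: leq_trans lt_k; apply: proper_card.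
  apply/fintype.properP; split.
    apply/fintype.subsetP => z; rewrite !finset.in_setD => /andP[zT ->].
    rewrite andbT; apply: contra zT => zT.
    by apply: (fintype.subsetP sub); rewrite in_setU1 zT orbT.
  exists w; first by rewrite finset.in_setD wT.
  by rewrite finset.in_setD (fintype.subsetP sub) // setU11.
Qed.

End Kernel.

(** * Commutation modulo inner automorphisms *)

Section Commutation.
Variable G : sgraph.
Hypothesis conn : graph_connected G.
Implicit Types (v w x : G) (S T : {set G}).

(** The two automorphisms compose to the conjugation by a power of [v]. *)
Lemma out_class_pc_compl v S n (vS : conj_compatible v S)
    (vS' : conj_compatible v (~: (v |: S))%SET) :
  out_class (pc vS n) = (out_class (pc vS' n))^-1.
Proof.
apply: (mulIg (out_class (pc vS' n))); rewrite mulVg -gmulfM.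
suff -> : pc vS n * pc vS' n = conj_aut (zpow (gen v) n) by exact: out_class_conj.
apply: aut_raag_eq => x; rewrite aut_mulgE /= [pc vS' n _]pcE !inE.
case: (eqVneq x v) => [->|xv] /=.
  by rewrite pc_center gen_st_conj // !inE eqxx.
by case xS: (x \in S) => /=; rewrite ?aut_conj ?aut_zpow ?pc_center pcE xS.
Qed.

Lemma pc_commute_center v S T m n (vS : conj_compatible v S)
    (vT : conj_compatible v T) : commute (pc vS m) (pc vT n).
Proof.
apply: aut_raag_eq => x; rewrite !aut_mulgE !pcE.
case: ifP => xT; case: ifP => xS; rewrite ?aut_conj ?aut_zpow ?pc_center !pcE xS xT //.
by rewrite -!conjgM -!zpowD addrC.
Qed.

(** If [S] and [T] met, their intersection would be closed under adjacency and contain [v] by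
    connectedness. So they are disjoint, and each automorphism fixes the centre of the other. *)
Lemma pc_commute_disjoint v w S T m n (vS : conj_compatible v S)
    (wT : conj_compatible w T) :
  v != w ->
  closed_away v S -> closed_away w T -> w \notin S -> v \notin T ->
  commute (pc vS m) (pc wT n).
Proof.
move=> vw [nvS vSP] [nwT wTP] wS vT.
have disj x : x \in S -> x \in T -> False.
  move=> xS xT; have : v \in (S :&: T)%SET.
    apply: (connected_ind conn (x := x)); first by rewrite inE xS.
    move=> y z; rewrite !inE => /andP[yS yT] yz.
    have zv : z != v.
      by apply: contraNneq vT => zv; apply: (wTP y) vw; rewrite // -zv.
    have zw : z != w.
      by apply: contraNneq wS => zw; apply: (vSP y); rewrite // 1?eq_sym // -zw.
    by rewrite (vSP y z yS yz zv) (wTP y z yT yz zw).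
  by rewrite inE (negPf nvS).
apply: aut_raag_eq => x; rewrite !aut_mulgE !pcE.
case: ifP => xT; case: ifP => xS; first by case: (disj x).
- by rewrite aut_conj aut_zpow !pcE xS (negPf wS) xT.
- by rewrite aut_conj aut_zpow !pcE xT (negPf vT) xS.
- by rewrite !pcE xS xT.
Qed.

(* Modulo inner automorphisms, each of the two sets may be replaced by its
   complement, so that they become disjoint from the other centre. *)
Lemma out_class_pc_commute v w S T (vS : conj_compatible v S)
    (wT : conj_compatible w T) :
  closed_away v S -> closed_away w T ->
  commute (out_class (pc vS 1%R)) (out_class (pc wT 1%R)).
Proof.
have class_commute (f g : aut (raag G)) :
    commute f g -> commute (out_class f) (out_class g).
  by rewrite /commute -!gmulfM => ->.
case: (eqVneq v w) => [vw|vw].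
  by subst w; move=> _ _; apply/class_commute/pc_commute_center.
have half R (vR : conj_compatible v R) : closed_away v R -> closed_away w T ->
    w \notin R -> commute (out_class (pc vR 1%R)) (out_class (pc wT 1%R)).
  move=> cR cT wR; have [vT|vT] := boolP (v \in T); last first.
    by apply: class_commute; apply: pc_commute_disjoint.
  have cT' := closed_away_compl cT.
  rewrite (out_class_pc_compl _ _ (closed_away_compatible cT')).
  apply: commuteV; apply: class_commute; apply: pc_commute_disjoint => //.
  by rewrite !inE vT orbT.
move=> cS cT; have [wS|wS] := boolP (w \in S); last exact: half.
have cS' := closed_away_compl cS.
rewrite (out_class_pc_compl _ _ (closed_away_compatible cS')).
apply/commute_sym/commuteV/commute_sym/half => //.
by rewrite !inE wS orbT.
Qed.

End Commutation.

(** * Differences of exponents *)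

Section ExponentDifference.
Variables (G : sgraph) (v x y : G).

(** An inner automorphism shifts both exponents equally, so for [x] and [y] outside [st v] the
    difference depends only on the class. The clause on all generators makes exponents additive
    under composition. *)
Definition exponent_diff (o : out (raag G)) (d : int) :=
  exists f : aut (raag G),
    [/\ out_class f = o, forall u, exists b, f (gen u) = gen u ^ b
      & exists kx ky, [/\ conj_exponent f v x kx, conj_exponent f v y ky
                        & d = (kx - ky)%R]].

Lemma exponent_diff1 : exponent_diff 1 0%R.
Proof.
exists 1; split=> [//|u|]; first by exists 1; rewrite conjg1.
exists 0%R, 0%R; split; rewrite ?subrr //.
- by exists 1; rewrite ?expo1 ?conjg1.
- by exists 1; rewrite ?expo1 ?conjg1.
Qed.

(** The product conjugates by [a * f b], and [f] preserves exponent sums because it conjugates every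
    generator. *)
Lemma conj_exponentM (f g : aut (raag G)) u k l :
  (forall u, exists b, f (gen u) = gen u ^ b) ->
  conj_exponent f v u k -> conj_exponent g v u l ->
  conj_exponent (f * g) v u (k + l)%R.
Proof.
move=> fc [a fa <-] [b gb <-]; exists (a * f b).
  by rewrite aut_mulgE gb aut_conj fa conjgM.
rewrite expoM; congr (_ + _)%R; apply: (expo_morph (f := f)) => w.
by have [c fw] := fc w; rewrite [X in expo v X]fw expoJ.
Qed.

Lemma exponent_diffM o p d e : exponent_diff o d -> exponent_diff p e ->
  exponent_diff (o * p) (d + e)%R.
Proof.
move=> [f [<- fc [kx [ky [fx fy ->]]]]] [g [<- gc [lx [ly [gx gy ->]]]]].
exists (f * g); split; first exact: gmulfM.
  move=> u; have [a fa] := fc u; have [b gb] := gc u; exists (a * f b).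
  by rewrite aut_mulgE gb aut_conj fa conjgM.
exists (kx + lx)%R, (ky + ly)%R; split; [exact: conj_exponentM..|].
by rewrite opprD addrACA.
Qed.

Lemma exponent_diff_trivial d :
  x \notin st v -> y \notin st v -> exponent_diff 1 d -> d = 0%R.
Proof.
move=> xv yv [f [/out_class1P[a fa] _ [kx [ky [fx fy ->]]]]].
have fu u : conj_exponent f v u (expo v a) by exists a.
by rewrite (conj_exponent_inj xv fx (fu x)) (conj_exponent_inj yv fy (fu y)) subrr.
Qed.

Lemma exponent_diff_pc w S n (wS : conj_compatible w S) :
  exponent_diff (out_class (pc wS n))
    (if w == v then n * ((x \in S)%:R - (y \in S)%:R) else 0)%R.
Proof.
have pcu u : conj_exponent (pc wS n) v u (if w == v then n * (u \in S)%:R else 0)%R.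
  rewrite /conj_exponent pcE; case: ifP => uS.
    exists (zpow (gen w) n) => //.
    by rewrite expo_zpow expo_gen eq_sym; case: ifP; rewrite ?mulr0 ?mulr1.
  by exists 1; rewrite ?conjg1 // expo1; case: ifP; rewrite ?mulr0.
exists (pc wS n); split=> // [u|]; first by have [b] := pcu u; exists b.
exists (if w == v then n * (x \in S)%:R else 0)%R,
  (if w == v then n * (y \in S)%:R else 0)%R; split=> //.
by case: ifP; rewrite ?subrr // mulrBr.
Qed.

End ExponentDifference.

(** * Rank of the kernel *)

Section NonleafComponents.
Variable G : sgraph.
Hypotheses (conn : graph_connected G) (tf : triangle_free G)
  (e1 : (0 < #|edges G|)%N).
Implicit Types (v w x : G) (C : {set G}).

Definition nonleaf_comps v : {set {set G}} :=
  [set C in components (~: [set v]) | #|C| != 1%N]%SET.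

(** A component inside the link of [v] has no edges, by triangle-freeness, so it is a single
    vertex. *)
Lemma component_far_vertex v C : C \in nonleaf_comps v ->
  exists2 x, x \in C & x \notin st v.
Proof.
rewrite inE => /andP[Cv C1]; apply: contrapT => no.
have Cl x : x \in C -> adj v x.
  move=> xC; have xv := fintype.subsetP (components_sub Cv) x xC.
  apply: contrapT => /negP vx; apply: no; exists x => //.
  by move: xv; rewrite !inE negb_or => ->.
have [x xC] := components_inh Cv.
have sub : C \subset [set x]%SET.
  rewrite (components_eq Cv xC); apply: comp_of_min; first exact: set11.
  move=> y z; rewrite inE => /eqP-> xv zv xz.
  have zC := components_adj Cv xC xz zv.
  by have := tf_adj tf (Cl x xC) (Cl z zC); rewrite xz.
case/negP: C1; apply/cards1P; exists x; apply/eqP.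
by rewrite finset.eqEsubset sub finset.sub1set.
Qed.

Lemma leaf_component v C :
  (C \in components (~: [set v])%SET) && (#|C| == 1%N) =
  (C \in [set [set w]%SET | w in [set w in lk v | leaf w]]%SET).
Proof.
apply/andP/imsetP => [[Cv /cards1P[w CE]]|[w]].
  have wC : w \in C by rewrite CE set11.
  have lkw : lk w = [set v]%SET.
    apply/eqP; rewrite finset.eqEsubset; apply/andP; split.
      apply/fintype.subsetP => z; rewrite !inE => wz; apply: contrapT => /negP zv.
      have : z \in C by apply: components_adj Cv wC wz _; rewrite !inE.
      by rewrite CE inE => /eqP zw; move: wz; rewrite zw adj_irr.
    have /card_gt0P[z wz] := connected_lk w conn e1.
    suff <- : z = v by rewrite finset.sub1set.
    apply: contrapT => /eqP zv; rewrite inE in wz.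
    have : z \in C by apply: components_adj Cv wC wz _; rewrite !inE.
    by rewrite CE inE => /eqP zw; move: wz; rewrite zw adj_irr.
  by exists w => //; rewrite inE lk_sym lkw set11 /leaf lkw cards1.
rewrite inE => /andP[wv /cards1P[u uE]] ->.
have vw : v \in lk w by rewrite lk_sym.
have uv : u = v by move: vw; rewrite uE inE => /eqP.
split; last by rewrite cards1.
apply/componentsP; exists w.
  by rewrite !inE; apply: contraTneq wv => ->; rewrite inE adj_irr.
apply/eqP; rewrite finset.eqEsubset finset.sub1set comp_of_id ?andTb; last first.
  by rewrite !inE; apply: contraTneq wv => ->; rewrite inE adj_irr.
apply: comp_of_min; first exact: set11.
move=> y z; rewrite inE => /eqP-> _; rewrite !inE => zv wz.
have : z \in lk w by rewrite inE.
by rewrite uE uv inE (negPf zv).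
Qed.

Lemma deltaC_split v : deltaC v = (#|nonleaf_comps v| + num_leaves v)%N.
Proof.
rewrite /deltaC -(cardsID [set C : {set G} | #|C| == 1%N]%SET) addnC.
congr (_ + _)%N.
  by apply: eq_card => C; rewrite !inE andbC.
rewrite /num_leaves -[RHS](card_imset _ (@finset.set1_inj G)); apply: eq_card => C.
by rewrite -leaf_component !inE.
Qed.

(** If all components were leaves, the graph would be [st v]. *)
Lemma nonleaf_comps_neq0 v : ~~ is_star G -> nonleaf_comps v != finset.set0.
Proof.
move=> ns; apply: contraNneq ns => n0; apply/existsP; exists v.
apply/eqP/setP => w; rewrite [RHS]inE in_setU1; apply/orP.
case: (eqVneq w v) => [->|wv]; [by left|right].
have wv' : w \in (~: [set v])%SET by rewrite !inE.
have Cv : comp_of (~: [set v])%SET w \in components (~: [set v])%SET.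
  by apply/componentsP; exists w.
have : comp_of (~: [set v])%SET w \notin nonleaf_comps v by rewrite n0 inE.
rewrite inE Cv /= negbK => C1.
have := leaf_component v (comp_of (~: [set v])%SET w); rewrite Cv C1.
move/esym/imsetP=> [u]; rewrite inE => /andP[uv _] wu.
by have := comp_of_id wv'; rewrite wu inE => /eqP->.
Qed.

End NonleafComponents.

Section FreeAbelian.
Variables (G : sgraph) (V0 : {set G}).
Hypotheses (conn : graph_connected G) (tf : triangle_free G)
  (e2 : (1 < #|edges G|)%N) (nstar : ~~ is_star G) (V0P : is_V0 V0).
Implicit Types (v w x : G) (C S : {set G}).

Let e1 : (0 < #|edges G|)%N := ltnW e2.

(** The component left out of the basis at [v]. By [base_compP], the default does not occur outside
    stars. *)
Definition base_comp v : {set G} :=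
  odflt finset.set0 [pick C in nonleaf_comps v].

Lemma base_compP v : base_comp v \in nonleaf_comps v.
Proof.
rewrite /base_comp; case: pickP => [//|no].
have /finset.set0Pn[C] := nonleaf_comps_neq0 conn e1 v nstar.
by rewrite no.
Qed.

Definition basis_index : {set G * {set G}} :=
  [set p | (p.1 \in V0) && (p.2 \in nonleaf_comps p.1 :\ base_comp p.1)]%SET.

Lemma card_basis_index : #|basis_index|%:Z%R =
  (\sum_(v in V0) ((deltaC v)%:Z - (num_leaves v)%:Z - 1))%R.
Proof.
rewrite -sum1_card (eq_bigl (fun p : G * {set G} => (p.1 \in V0) &&
    (p.2 \in nonleaf_comps p.1 :\ base_comp p.1)%SET)); last first.
  by move=> p; rewrite [LHS]inE.
rewrite -(pair_big_dep _ (fun v C => (C \in nonleaf_comps v :\ base_comp v)%SET)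
  (fun _ _ => 1%N)) /=.
rewrite (big_morph Posz PoszD (erefl _)); apply: eq_bigr => v _.
rewrite sum1_card (deltaC_split conn e1) (cardsD1 (base_comp v) (nonleaf_comps v)).
by rewrite base_compP !PoszD addrK addrC addKr.
Qed.

(** An element of [V0] dominating [v] and different from [v] is adjacent to all neighbours of [v],
    which makes Gamma - v connected. *)
Lemma separating_V0 v : separating v -> v \in V0.
Proof.
move=> /card_gt1P[C [D [Cv Dv CD]]].
have [w wV vw] := V0_cover conn nstar V0P v.
case: (eqVneq w v) => [<- //|wv]; case/eqP: CD.
have wv' : w \in (~: [set v])%SET by rewrite !inE.
pose E := comp_of (~: [set v])%SET w.
have Ev : E \in components (~: [set v])%SET by apply/componentsP; exists w.
have all_E x : x \in (v |: E)%SET.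
  apply: (connected_ind conn (x := w)); first by rewrite in_setU1 comp_of_id ?orbT.
  move=> y z; rewrite !in_setU1 => yE yz.
  case: (eqVneq z v) => //= zv; have zv' : z \in (~: [set v])%SET by rewrite !inE.
  case/orP: yE => [/eqP yv|yE]; last exact: components_adj Ev yE yz zv'.
  apply: (components_adj Ev (comp_of_id wv')) zv'.
  by have := fintype.subsetP vw z; rewrite !inE -yv; apply.
have eq_E F : F \in components (~: [set v])%SET -> F = E.
  move=> Fv; have [x xF] := components_inh Fv.
  apply: (components_meet Fv Ev xF); have := all_E x; rewrite in_setU1.
  by have := fintype.subsetP (components_sub Fv) x xF; rewrite !inE => /negPf->.
by rewrite (eq_E C Cv) (eq_E D Dv).
Qed.

Local Notation r := #|basis_index|.

Definition index_pair (i : 'I_r) : G * {set G} := enum_val i.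

Lemma index_pairP i : (index_pair i).1 \in V0 /\
  (index_pair i).2 \in (nonleaf_comps (index_pair i).1
                          :\ base_comp (index_pair i).1)%SET.
Proof. by have := enum_valP i; rewrite inE => /andP. Qed.

Lemma index_component i :
  (index_pair i).2 \in components (~: [set (index_pair i).1])%SET.
Proof. by have [_] := index_pairP i; rewrite !inE => /and3P[]. Qed.

Definition basis_pc i n :=
  pc (closed_away_compatible (component_closed_away (index_component i))) n.

Definition basis i : out (raag G) := out_class (basis_pc i 1%R).

Lemma basis_commute i j : commute (basis i) (basis j).
Proof.
by apply: out_class_pc_commute => //; apply/component_closed_away/index_component.
Qed.

Lemma basis_zpow i n : zpow (basis i) n = out_class (basis_pc i n).
Proof. by rewrite /basis /basis_pc [in RHS]pc_zpow gmulf_zpow. Qed.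

Definition kernel_hom (z : 'rV[int]_r) : out (raag G) :=
  \prod_(i < r) zpow (basis i) (z ord0 i).

Lemma kernel_homD (y z : 'rV[int]_r) :
  kernel_hom (y + z)%R = kernel_hom y * kernel_hom z.
Proof.
rewrite -prodgM_commute => [|i j _ _]; last exact/commute_zpow2/basis_commute.
by apply: eq_bigr => i _; rewrite mxE zpowD.
Qed.

Lemma kernel_hom0 : kernel_hom 0%R = 1.
Proof. by apply: big1 => i _; rewrite mxE. Qed.

Lemma kernel_homN z : kernel_hom (- z)%R = (kernel_hom z)^-1.
Proof.
by apply: (mulgI (kernel_hom z)); rewrite -kernel_homD subrr kernel_hom0 mulgV.
Qed.

Lemma kernel_hom_delta i : kernel_hom (delta_mx ord0 i) = basis i.
Proof.
rewrite /kernel_hom (eq_bigr (fun j => if j == i then basis j else 1)).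
  by rewrite -big_mkcond big_pred1_eq.
by move=> j _; rewrite mxE eqxx /=; case: eqP => // _; rewrite zpow1.
Qed.

(** Among the basis elements with the centre of the [i]-th, only the [i]-th conjugates [x], and none
    conjugates [y], which is in the omitted component. *)
Lemma kernel_hom_exponent z i x y : x \in (index_pair i).2 ->
  y \in base_comp (index_pair i).1 ->
  exponent_diff (index_pair i).1 x y (kernel_hom z) (z ord0 i).
Proof.
move=> xC yB; have -> : z ord0 i = (\sum_(j < r) if j == i then z ord0 j else 0)%R.
  by rewrite -big_mkcond big_pred1_eq.
rewrite /kernel_hom; apply: big_ind2.
- exact: exponent_diff1.
- by move=> o d p e; apply: exponent_diffM.
move=> j _; rewrite basis_zpow.
have := exponent_diff_pc (index_pair i).1 x y (z ord0 j)
  (closed_away_compatible (component_closed_away (index_component j))).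
congr exponent_diff; case: (eqVneq j i) => [->|ji].
  have [_] := index_pairP i; rewrite eqxx xC in_setD1 => /andP[Cb _].
  suff /negPf-> : y \notin (index_pair i).2 by rewrite subr0 mulr1.
  apply: contra Cb => yC; apply/eqP.
  apply: components_meet (index_component i) _ yC yB.
  by have := base_compP (index_pair i).1; rewrite inE => /andP[].
case: eqP => // vji.
have [_] := index_pairP j; rewrite vji in_setD1 => /andP[Cb _].
have Cj : (index_pair j).2 \in components (~: [set (index_pair i).1])%SET.
  by rewrite -vji; apply: index_component.
have Bi : base_comp (index_pair i).1 \in components (~: [set (index_pair i).1])%SET.
  by have := base_compP (index_pair i).1; rewrite inE => /andP[].
have yCj : y \notin (index_pair j).2.
  by apply: contra Cb => yC; apply/eqP/(components_meet Cj Bi yC yB).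
have xCj : x \notin (index_pair j).2.
  apply: contra ji => xCj; apply/eqP/enum_val_inj.
  rewrite -/(index_pair j) -/(index_pair i) [LHS]surjective_pairing vji.
  by rewrite (components_meet Cj (index_component i) xCj xC) -surjective_pairing.
by rewrite (negPf xCj) (negPf yCj) subrr mulr0.
Qed.

Lemma kernel_hom_inj : injective kernel_hom.
Proof.
move=> y z yz; apply/eqP; rewrite -subr_eq0; apply/eqP/rowP => i.
have k1 : kernel_hom (y - z)%R = 1 by rewrite kernel_homD kernel_homN yz mulgV.
(* Both components contain a vertex outside the star of the centre, where the exponents are well
   defined. *)
have [_] := index_pairP i; rewrite in_setD1 => /andP[_ /(component_far_vertex tf)].
case=> a aC av; have [b bB bv] := component_far_vertex tf (base_compP (index_pair i).1).
rewrite [RHS]mxE; apply: exponent_diff_trivial av bv _.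
by rewrite -k1; apply: kernel_hom_exponent.
Qed.

Local Notation in_range o := (exists z, kernel_hom z = o).

Lemma in_rangeM o p : in_range o -> in_range p -> in_range (o * p).
Proof. by move=> [y <-] [z <-]; exists (y + z)%R; rewrite kernel_homD. Qed.

Lemma in_rangeV o : in_range o -> in_range o^-1.
Proof. by move=> [z <-]; exists (- z)%R; rewrite kernel_homN. Qed.

Lemma index_in_range v C (vC : conj_compatible v C) :
  v \in V0 -> C \in nonleaf_comps v -> C != base_comp v ->
  in_range (out_class (pc vC 1%R)).
Proof.
move=> vV CN Cb; have vCI : (v, C) \in basis_index.
  by rewrite inE vV in_setD1 Cb.
exists (delta_mx ord0 (enum_rank_in vCI (v, C))); rewrite kernel_hom_delta.
congr out_class; apply: conj_on_pc => u.
rewrite pcE zpow1 /index_pair enum_rankK_in //.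
Qed.

(** [S] is a union of components other than the base one. The non-leaf ones are peeled off in turn;
    the remaining leaves lie in [st v] and are not moved. *)
Lemma closed_in_range v S (vS : conj_compatible v S) :
  v \in V0 -> closed_away v S -> [disjoint S & base_comp v] ->
  in_range (out_class (pc vS 1%R)).
Proof.
move=> vV; have [k] := ubnP #|S|; elim: k S vS => // k ih S vS lt_S cS dS.
have [/fintype.subsetP Sv|/subsetPn[x xS xv]] := boolP (S \subset st v).
  exists 0%R; rewrite kernel_hom0 (_ : pc vS 1%R = 1) ?gmulf1 //.
  apply: aut_raag_eq => u; rewrite pcE; case: ifP => // /Sv.
  exact: gen_st_conj.
have [xv' xl] : x != v /\ x \notin lk v.
  by move: xv; rewrite in_setU1 negb_or => /andP[].
pose C := comp_of (~: [set v])%SET x.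
have xC : x \in C by apply: comp_of_id; rewrite !inE.
have Cv : C \in components (~: [set v])%SET.
  by apply/componentsP; exists x; rewrite // !inE.
have CS : C \subset S.
  apply: comp_of_min => // y z yS _ zv yz; apply: cS.2 yS yz _.
  by move: zv; rewrite !inE.
have CN : C \in nonleaf_comps v.
  rewrite inE Cv /=; apply: contraNN xl => C1.
  have := leaf_component conn e1 v C; rewrite Cv C1 => /esym/imsetP[w].
  by rewrite inE => /andP[wv _] CE; move: xC; rewrite CE inE => /eqP->.
have Cb : C != base_comp v.
  apply: contraTneq dS => Cb; apply/pred0Pn; exists x.
  by rewrite /= xS -Cb.
have vC := closed_away_compatible (component_closed_away Cv).
have cD : closed_away v (S :\: C)%SET.
  split=> [|y z]; first by rewrite inE (negPf cS.1) andbF.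
  rewrite !finset.in_setD => /andP[yC yS] yz zv; rewrite (cS.2 y) // andbT.
  apply: contra yC => zC; apply: (components_adj Cv zC); first by rewrite adj_sym.
  by rewrite !inE; apply: contraNneq cS.1 => <-.
have vD := closed_away_compatible cD.
rewrite (pc_setD _ vS vC vD CS) gmulfM; apply: in_rangeM.
  exact: index_in_range.
apply: ih => //.
  rewrite ltnS in lt_S; apply: leq_trans lt_S; apply: proper_card.
  apply/fintype.properP; split; first exact: finset.subsetDl.
  by exists x; rewrite // finset.in_setD xC.
apply: disjointWl dS; exact: finset.subsetDl.
Qed.

(** Modulo inner automorphisms this is the inverse of the conjugation on the union of the other
    components. *)
Lemma base_in_range v (vB : conj_compatible v (base_comp v)) : v \in V0 ->
  in_range (out_class (pc vB 1%R)).
Proof.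
move=> vV; have := base_compP v; rewrite inE => /andP[Bv _].
have cB' := closed_away_compl (component_closed_away Bv).
rewrite (out_class_pc_compl _ _ (closed_away_compatible cB')).
apply/in_rangeV/closed_in_range => //.
apply/pred0P => x; rewrite /= !inE negb_or.
by case: (x \in base_comp v); rewrite ?andbF.
Qed.

Lemma kernel_hom_range o :
  gen_subgroup (nonleaf_conjugations G) o <-> in_range o.
Proof.
split.
  move: o; apply: gen_subgroup_ind.
  - by exists 0%R; rewrite kernel_hom0.
  - exact: in_rangeM.
  - exact: in_rangeV.
  move=> _ [v [C [f [/separating_V0 vV Cv C1 fE <-]]]].
  have vC := closed_away_compatible (component_closed_away Cv).
  rewrite (conj_on_pc vC fE).
  case: (eqVneq C (base_comp v)) => [CB|CB].
    by subst C; apply: base_in_range.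
  by apply: index_in_range; rewrite // inE Cv.
move=> [z <-]; rewrite /kernel_hom; apply: big_ind.
- exact: gen_subgroup1.
- exact: gen_subgroupM.
move=> i _; rewrite basis_zpow; apply: out_class_pc_nonleaf (index_component i) _.
by have [_] := index_pairP i; rewrite in_setD1 inE => /and3P[].
Qed.

End FreeAbelian.

Lemma free_abelian_trivial (A : groupType) :
  free_abelian_of_rank ([set 1]%classic : set A) 0.
Proof.
exists (fun=> 1); split=> [y z _|y z|]; first by rewrite [y]thinmx0 [z]thinmx0.
  by rewrite mulg1.
by apply/seteqP; split=> [x [_ _ <-]|x ->]; [|exists 0%R].
Qed.

(** The join of the centre is the whole graph, so acting on it as a conjugation means being
    inner. *)
Lemma star_kernel (G : sgraph) (c : G) : triangle_free G ->
  (1 < #|lk c|)%N -> st c = [set: G]%SET ->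
  forall o, K0 [set c]%SET o -> o = 1.
Proof.
move=> tf lk2 stc o /K0P[//|v|f [_ <- fJ]]; first by rewrite inE => /eqP->.
have [a fa] := fJ c (set11 c).
apply/out_class1P; exists a => x; apply: fa.
rewrite (_ : join_of c = [set: G]%SET); first exact: special_full.
apply/setP => u; have : u \in st c by rewrite stc inE.
rewrite in_setU1 [RHS]finset.in_setT => /orP[/eqP->|uc].
  by rewrite join_center.
by rewrite lk_join //; move: uc; rewrite inE.
Qed.

Theorem proposition3p9 (G : sgraph) (V0 : {set G}) :
  graph_connected G -> triangle_free G -> (2 <= #|edges G|)%N ->
  is_V0 V0 ->
  K0 V0 = gen_subgroup (nonleaf_conjugations G) /\
  (exists r : nat,
    free_abelian_of_rank (K0 V0) r /\
    (if is_star G then K0 V0 = [set 1%g]%classic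
     else (r%:Z = \sum_(v in V0) ((deltaC v)%:Z - (num_leaves v)%:Z - 1))%R)).
Proof.
move=> conn tf e2 V0P; have [star|nstar] := boolP (is_star G).
  have [c [stc ->]] : exists v, st v = [set: G]%SET /\ V0 = [set v]%SET.
    by move: V0P; rewrite /is_V0 star.
  have lk2 : (1 < #|lk c|)%N := leq_trans e2 (star_lk tf stc).
  have Vlk v : v \in [set c]%SET -> (1 < #|lk v|)%N by rewrite inE => /eqP->.
  have K1 : K0 [set c]%SET = [set 1]%classic.
    apply/seteqP; split=> [o /(star_kernel tf lk2 stc)->//|o ->].
    by apply: nonleaf_conjugations_K0 => //; apply: gen_subgroup1.
  split; last by exists 0%N; rewrite K1; split=> //; apply: free_abelian_trivial.
  apply/seteqP; split=> o; last exact: nonleaf_conjugations_K0.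
  by rewrite K1 => ->; apply: gen_subgroup1.
have Vlk := V0_lk conn e2 nstar V0P.
have KE : K0 V0 = gen_subgroup (nonleaf_conjugations G).
  apply/seteqP; split=> o; last exact: nonleaf_conjugations_K0.
  case/(K0P _ tf Vlk) => f [_ <- fV].
  exact: conj_joins_nonleaf fV.
split=> //; exists #|basis_index V0|; split; last exact: card_basis_index.
exists (kernel_hom (V0 := V0)); split.
- exact: kernel_hom_inj.
- exact: kernel_homD.
rewrite KE; apply/seteqP; split=> o.
  by case=> z _ <-; apply/(kernel_hom_range conn e2 nstar V0P); exists z.
by move/(kernel_hom_range conn e2 nstar V0P) => [z <-]; exists z.
Qed.
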